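(* Let $\alpha>0$ and let $\mu$ be a positive Borel measure on $\mathbb{C}$. The following conditions are equivalent. (a) The Toeplitz operator $T_\mu$ is bounded on $F^2_h$. (b) $\widetilde{\mu}(z)$ is bounded on $\mathbb{C}$. (c) The measure $\mu$ is a harmonic Fock-Carleson measure for $F^2_h$.
   Context: Here $dA$ is area (Lebesgue) measure on $\mathbb{C}$ and $d\lambda_\alpha(z)=\frac{\alpha}{\pi}e^{-\alpha|z|^2}dA(z)$. The harmonic Fock space $F^2_h$ is the Hilbert space of all (complex-valued) harmonic functions $f$ on $\mathbb{C}$ with $\int_{\mathbb{C}}|f|^2d\lambda_\alpha<\infty$, with inner product $\langle f,g\rangle=\int_{\mathbb{C}}f\overline{g}\,d\lambda_\alpha$. For $z\in\mathbb{C}$ put $K_z(\omega)=e^{\alpha\bar z\omega}$, $H_z(\omega)=K_z(\omega)+\overline{K_z(\omega)}$, $k_z(\omega)=e^{\alpha\bar z\omega-\frac{\alpha}{2}|z|^2}$ and $h_z(\omega)=\frac{H_z(\omega)}{\sqrt{H_z(z)}}=\frac{\sqrt2}{2}\left(k_z(\omega)+\overline{k_z(\omega)}\right)$. The Toeplitz operator $T_\mu$ on $F^2_h$ is defined by $(T_\mu f)(z)=\int_{\mathbb{C}}f(\omega)\overline{H_z(\omega)}e^{-\alpha|\omega|^2}d\mu(\omega)$. The Berezin transform is $\widetilde{\mu}(z)=\int_{\mathbb{C}}|h_z(u)|^2e^{-\alpha|u|^2}d\mu(u)$. A positive Borel measure $\mu$ is a harmonic Fock-Carleson measure for $F^2_h$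 if there is a constant $C>0$ with $\int_{\mathbb{C}}|f(z)e^{-\alpha|z|^2/2}|^2 d\mu(z)\le C\int_{\mathbb{C}}|f(z)e^{-\alpha|z|^2/2}|^2 dA(z)$ for all $f\in F^2_h$. *)

(* Defs.v *)
From HB Require Import structures.
From mathcomp Require Import all_boot all_order all_algebra.
From mathcomp Require Import complex.
From mathcomp Require Import all_classical all_reals all_analysis.

Set Implicit Arguments.
Unset Strict Implicit.
Unset Printing Implicit Defensive.
Import Order.TTheory GRing.Theory Num.Theory.
Import numFieldNormedType.Exports.

Local Open Scope classical_set_scope.
Local Open Scope complex_scope.
Local Open Scope ring_scope.

(* The points of the complex plane are pairs (x, y) : R * R with the product
   topology; complex arithmetic is done in R[i], via [cpx].  Measures on the
   plane live on [measurableTypeR R * measurableTypeR R], whose carrier is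
   R * R and whose product sigma-algebra is the Borel sigma-algebra of the
   plane.  Moduli are taken in R[i]: the library norm on R * R is the sup
   norm. *)
Definition cpx (R : realType) (z : R * R) : R[i] := z.1 +i* z.2.

Definition cmod (R : realType) (z : R[i]) : R := ComplexField.Normc.normc z.

Definition cexp (R : realType) (z : R[i]) : R[i] :=
  (expR (complex.Re z))%:C * (cos (complex.Im z) +i* sin (complex.Im z)).

Definition area (R : realType) := (@lebesgue_measure R \x @lebesgue_measure R)%E.

Definition cintegrable (R : realType) (d : measure_display)
    (T : measurableType d) (mu : {measure set T -> \bar R})
    (f : T -> R[i]) : Prop :=
  mu.-integrable [set: T] (fun x => (complex.Re (f x))%:E) /\
  mu.-integrable [set: T] (fun x => (complex.Im (f x))%:E).

Definition cintegral (R : realType) (d : measure_display)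
    (T : measurableType d) (mu : {measure set T -> \bar R})
    (f : T -> R[i]) : R[i] :=
  Rintegral mu [set: T] (fun x => complex.Re (f x)) +i*
  Rintegral mu [set: T] (fun x => complex.Im (f x)).

Definition dx (R : realType) (u : R * R -> R) : R * R -> R :=
  'D_((1, 0) : R * R) u.

Definition dy (R : realType) (u : R * R -> R) : R * R -> R :=
  'D_((0, 1) : R * R) u.

Definition C1 (R : realType) (u : R * R -> R) : Prop :=
  [/\ forall z, derivable u z ((1, 0) : R * R),
      forall z, derivable u z ((0, 1) : R * R),
      continuous (dx u) & continuous (dy u)].

Definition C2 (R : realType) (u : R * R -> R) : Prop :=
  [/\ C1 u, C1 (dx u) & C1 (dy u)].

Definition real_harmonic (R : realType) (u : R * R -> R) : Prop :=
  C2 u /\ forall z, dx (dx u) z + dy (dy u) z = 0.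

Definition harmonic_fun (R : realType) (f : R * R -> R[i]) : Prop :=
  real_harmonic (fun z => complex.Re (f z)) /\
  real_harmonic (fun z => complex.Im (f z)).

Section HarmonicFock.
Variables (R : realType) (alpha : R).
Implicit Types (f g : R * R -> R[i]) (z w u : R * R).

Definition gauss z : R := expR (- alpha * cmod (cpx z) ^+ 2).

(* density of d lambda_alpha = alpha / pi e^(- alpha |z|^2) dA *)
Definition fock_density z : R := alpha / pi * gauss z.

Definition in_fock f : Prop :=
  harmonic_fun f /\
  (\int[@area R]_z (cmod (f z) ^+ 2 * fock_density z)%:E < +oo)%E.

Definition fock_inner f g : R[i] :=
  cintegral (@area R) (fun z => f z * (g z)^* * (fock_density z)%:C).

Definition fock_norm f : R := Num.sqrt (complex.Re (fock_inner f f)).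

Definition fock_K z w : R[i] := cexp (alpha%:C * (cpx z)^* * cpx w).

Definition fock_H z w : R[i] := fock_K z w + (fock_K z w)^*.

Definition fock_h z w : R[i] := fock_H z w / sqrtC (fock_H z z).

Variable mu : {measure set (measurableTypeR R * measurableTypeR R) -> \bar R}.

Definition toeplitz_integrand f z w : R[i] :=
  f w * (fock_H z w)^* * (gauss w)%:C.

Definition toeplitz f z : R[i] := cintegral mu (toeplitz_integrand f z).

(* [cintegral] is total, so that the integrals defining [toeplitz f] converge
   for all f in the space is part of the condition. *)
Definition toeplitz_bounded : Prop :=
  [/\ forall f, in_fock f -> forall z, cintegrable mu (toeplitz_integrand f z),
      forall f, in_fock f -> in_fock (toeplitz f) &
      exists C : R, forall f, in_fock f ->
        fock_norm (toeplitz f) <= C * fock_norm f].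

Definition berezin z : \bar R :=
  (\int[mu]_u (cmod (fock_h z u) ^+ 2 * gauss u)%:E)%E.

Definition berezin_bounded : Prop :=
  exists M : R, forall z, (berezin z <= M%:E)%E.

Definition weighted f z : R[i] :=
  f z * (expR (- alpha * cmod (cpx z) ^+ 2 / 2))%:C.

Definition fock_carleson : Prop :=
  exists2 C : R, 0 < C & forall f, in_fock f ->
    (\int[mu]_z (cmod (weighted f z) ^+ 2)%:E <=
     C%:E * \int[@area R]_z (cmod (weighted f z) ^+ 2)%:E)%E.

End HarmonicFock.

(* Main.v *)
Require Import Defs.
From HB Require Import structures.
From mathcomp Require Import all_boot all_order all_algebra.
From mathcomp Require Import complex.
From mathcomp Require Import all_classical all_reals all_analysis.
From mathcomp Require Import measurable_realfun.
From mathcomp Require Import ring lra.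
Set Implicit Arguments.
Unset Strict Implicit.
Unset Printing Implicit Defensive.
Import Order.TTheory GRing.Theory Num.Theory.
Import numFieldNormedType.Exports.
Local Open Scope classical_set_scope.
Local Open Scope ring_scope.

(** Everything reduces to real harmonic functions u and to their weighted
    energy, the integral of u^2 e^(- alpha |z|^2), because the kernel H_z is
    real: the real and the imaginary part of f never interact.

    The analytic core is that u^2 e^(- alpha |z|^2) at a point c is controlled
    by nearby values, although on a unit box around c the weight varies by a
    factor exponential in |c|.  For a holomorphic F = u + i Q this is classical: the
    function F(v)^2 e^(-2 alpha conj(c) (v - c)) is again holomorphic, and its
    modulus is |F(v)|^2 e^(- alpha |v|^2) up to a constant and to the radial
    factor e^(alpha |v - c|^2), so the mean value property applies
    ([local_submean]).  The real function u by itself has no such local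
    estimate at hand, so it is completed to F by a harmonic conjugate Q with
    Q(0) = 0 ([harmonic_conjugate]), and the completion is affordable: u^2 - Q^2
    is the real part of F^2, whose mean over discs is u(0)^2 >= 0, so the energy
    of Q is at most that of u ([conjugate_energy]).

    The mean value property against a radial weight ([mean_value]) is obtained
    in Cartesian coordinates.  Dilating the argument of F about c is, up to the
    factor i, rotating it; a radial weight annihilates infinitesimal rotations,
    by the divergence theorem; so the weighted mean of the dilated function does
    not depend on the dilation factor.

    On the side of the measure, the Berezin transform is the integral of
    2 cos(alpha Im(conj(z) u))^2 e^(- alpha |u - z|^2).  The cosine has zeros
    close to z when |z| is large, but the densities at two well chosen points
    do not vanish together ([two_densities]), so a bounded Berezin transform
    bounds the mass of all boxes of one fixed size ([berezin_box_bounded]).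
    With the local estimate and Tonelli's theorem this is the Carleson
    inequality ([real_carleson]), and conversely the Carleson inequality for
    h_z is the bound on the Berezin transform at z.

    For the Toeplitz operator, |H_z(w)| e^(- alpha (|z|^2 + |w|^2) / 2) is at
    most 2 e^(- alpha |z - w|^2 / 2), whose integrals in either variable are
    bounded, so Schur's test and the Carleson inequality give boundedness
    ([toeplitz_energy]); the image is harmonic by differentiation under the
    integral ([transform_harmonic]).  Conversely the value of T_mu H_z at z is
    the integral of H_z^2 e^(- alpha |w|^2) against mu, a multiple of the Berezin
    transform at z, and point evaluations are bounded ([real_pointwise]). *)

(** * Partial derivatives in the plane *)

(** The pairs of one-dimensional derivatives are easier to compute with than
    the directional derivatives in the normed space R * R. *)
Definition partials {R : realType} (u ux uy : R * R -> R) : Prop :=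
  forall x y : R,
    is_derive x 1 (fun s : R => u (s, y)) (ux (x, y)) /\
    is_derive y 1 (fun s : R => u (x, s)) (uy (x, y)).

Section partials.
Context {R : realType}.
Implicit Types (u v ux uy : R * R -> R).

Lemma dx_quotientE u (x y : R) :
  (fun h : R => h^-1 *: ((u \o shift (x, y)) (h *: ((1, 0) : R * R)) - u (x, y))) =
  (fun h : R => h^-1 *: (((fun s => u (s, y)) \o shift x) (h *: (1 : R)) - u (x, y))).
Proof.
apply/funext => h; congr (_ *: (u _ - _)).
by rewrite /=; congr (_, _); rewrite /= /GRing.scale/= mulr0 add0r.
Qed.

Lemma dy_quotientE u (x y : R) :
  (fun h : R => h^-1 *: ((u \o shift (x, y)) (h *: ((0, 1) : R * R)) - u (x, y))) =
  (fun h : R => h^-1 *: (((fun s => u (x, s)) \o shift y) (h *: (1 : R)) - u (x, y))).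
Proof.
apply/funext => h; congr (_ *: (u _ - _)).
by rewrite /=; congr (_, _); rewrite /= /GRing.scale/= mulr0 add0r.
Qed.

Lemma derivable_xE u (x y : R) :
  derivable u (x, y) ((1, 0) : R * R) = derivable (fun s : R => u (s, y)) x 1.
Proof. by rewrite /derivable dx_quotientE. Qed.

Lemma derivable_yE u (x y : R) :
  derivable u (x, y) ((0, 1) : R * R) = derivable (fun s : R => u (x, s)) y 1.
Proof. by rewrite /derivable dy_quotientE. Qed.

Lemma dxE u (x y : R) : dx u (x, y) = 'D_1 (fun s : R => u (s, y)) x.
Proof. by rewrite /dx /derive dx_quotientE. Qed.

Lemma dyE u (x y : R) : dy u (x, y) = 'D_1 (fun s : R => u (x, s)) y.
Proof. by rewrite /dy /derive dy_quotientE. Qed.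

Lemma partials_derivable u : (forall z, derivable u z ((1, 0) : R * R)) ->
  (forall z, derivable u z ((0, 1) : R * R)) -> partials u (dx u) (dy u).
Proof.
move=> ux uy x y; rewrite dxE dyE; split; apply: DeriveDef => //.
  by rewrite -derivable_xE.
by rewrite -derivable_yE.
Qed.

Lemma dx_partials u ux uy : partials u ux uy -> dx u = ux.
Proof.
by move=> uP; apply/funext => -[x y]; rewrite dxE; exact: (@derive_val _ _ _ _ _ _ _ (uP x y).1).
Qed.

Lemma dy_partials u ux uy : partials u ux uy -> dy u = uy.
Proof.
by move=> uP; apply/funext => -[x y]; rewrite dyE; exact: (@derive_val _ _ _ _ _ _ _ (uP x y).2).
Qed.

Lemma C1_partials u : C1 u -> partials u (dx u) (dy u).
Proof. by move=> [? ? _ _]; exact: partials_derivable. Qed.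

Lemma partials_C1 u ux uy : partials u ux uy -> continuous ux -> continuous uy ->
  C1 u.
Proof.
move=> uP cx cy; split.
- by move=> [x y]; rewrite derivable_xE; exact: (@ex_derive _ _ _ _ _ _ _ (uP x y).1).
- by move=> [x y]; rewrite derivable_yE; exact: (@ex_derive _ _ _ _ _ _ _ (uP x y).2).
- by rewrite (dx_partials uP).
- by rewrite (dy_partials uP).
Qed.

(** The mean value theorem for f(t) - c t; the endpoints come in either order
    because the increments in the plane have no sign. *)
Lemma derive_increment (f f' : R -> R) (a b c e : R) :
  (forall x : R, is_derive x 1 f (f' x)) ->
  (forall x, Num.min a b <= x <= Num.max a b -> `|f' x - c| <= e) ->
  `|f b - f a - c * (b - a)| <= e * `|b - a|.
Proof.
move=> fd fe.
have cf (p q : R) : {within `[p, q], continuous f}.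
  apply: derivable_within_continuous => x _.
  exact: (@ex_derive _ _ _ _ _ _ _ (fd x)).
have [ab|ba] := leP a b.
  have [x] := @MVT_segment R f f' a b ab (fun x _ => fd x) (cf _ _).
  rewrite in_itv/= => xab ->; rewrite -mulrBl normrM ler_wpM2r// fe//.
  by rewrite (min_idPl ab) (max_idPr ab).
have [x] := @MVT_segment R f f' b a (ltW ba) (fun x _ => fd x) (cf _ _).
rewrite in_itv/= => xab E.
have -> : f b - f a - c * (b - a) = (f' x - c) * (b - a).
  by rewrite -(opprB (f a)) E; ring.
rewrite normrM ler_wpM2r// fe//.
by rewrite (min_idPr (ltW ba)) (max_idPl (ltW ba)).
Qed.

Lemma plane_continuousP (f : R * R -> R) : continuous f <->
  forall (z : R * R) (e : R), 0 < e -> exists2 d : R, 0 < d &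
    forall h k : R, `|h| < d -> `|k| < d ->
      `|f (z.1 + h, z.2 + k) - f z| <= e.
Proof.
split=> [cf z e e0|cf z].
  have /cvgrPdist_le /(_ e e0) /nbhs_ballP[d /= d0 dg] := cf z.
  exists d => // h k hd kd; rewrite distrC; apply: dg.
  by split => /=; rewrite -ball_normE /= opprD addNKr normrN.
apply/cvgrPdist_le => e e0; apply/(@nbhs_ballP R (R * R)%type).
have [d d0 H] := cf z e e0; exists d => //= -[x y] [/=].
rewrite -!ball_normE/= => bx by_.
rewrite distrC; have := H (x - z.1) (y - z.2); rewrite !subrKC; apply.
  by rewrite distrC.
by rewrite distrC.
Qed.

(** Continuous partial derivatives give total differentiability: the increment
    is split into a horizontal and a vertical step. *)
Lemma partials_increment u ux uy : partials u ux uy ->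
  continuous ux -> continuous uy -> forall (x y e : R), 0 < e ->
  exists2 d : R, 0 < d & forall h k : R, `|h| < d -> `|k| < d ->
    `|u (x + h, y + k) - u (x, y) - (ux (x, y) * h + uy (x, y) * k)|
      <= e * (`|h| + `|k|).
Proof.
move=> uP cx cy x y e e0.
have near_xy (g : R * R -> R) : continuous g -> exists2 d : R, 0 < d &
    forall h k : R, `|h| < d -> `|k| < d -> `|g (x + h, y + k) - g (x, y)| <= e.
  by move=> /plane_continuousP /(_ (x, y) e e0).
have [d1 d10 H1] := near_xy _ cx; have [d2 d20 H2] := near_xy _ cy.
exists (Num.min d1 d2); first by rewrite lt_min d10.
move=> h k; rewrite !lt_min => /andP[h1 h2] /andP[k1 k2].
have ran (p q t : R) : Num.min p (p + q) <= t <= Num.max p (p + q) ->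
    `|t - p| <= `|q|.
  have [|] := lerP p (p + q) => pq /andP[t1 t2].
    by rewrite !ger0_norm; lra.
  by rewrite !ler0_norm; lra.
have A := @derive_increment (fun s => u (s, y + k)) (fun s => ux (s, y + k))
  x (x + h) (ux (x, y)) e (fun s => (uP s (y + k)).1).
have B := @derive_increment (fun s => u (x, s)) (fun s => uy (x, s))
  y (y + k) (uy (x, y)) e (fun s => (uP x s).2).
have {}A : `|u (x + h, y + k) - u (x, y + k) - ux (x, y) * h| <= e * `|h|.
  have := A; rewrite (addrC x h) addrK; apply => t tx.
  rewrite -(subrKC x t) H1// (le_lt_trans _ h1)// ran//.
  by rewrite (addrC x h).
have {}B : `|u (x, y + k) - u (x, y) - uy (x, y) * k| <= e * `|k|.
  have := B; rewrite (addrC y k) addrK; apply => t ty.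
  rewrite -{1}(addr0 x) -(subrKC y t) H2// ?normr0// (le_lt_trans _ k2)// ran//.
  by rewrite (addrC y k).
rewrite mulrDr; apply: le_trans (lerD A B); apply: le_trans (ler_normD _ _).
by rewrite le_eqVlt; apply/orP; left; apply/eqP; congr `| _ |; ring.
Qed.

Lemma partials_continuous u ux uy : partials u ux uy ->
  continuous ux -> continuous uy -> continuous u.
Proof.
move=> uP cx cy; apply/plane_continuousP => -[x y] e e0 /=.
have [d d0 H] := partials_increment uP cx cy x y ltr01.
pose K := 1 + `|ux (x, y)| + `|uy (x, y)|.
have K0 : 0 < K by rewrite /K -addrA ltr_pwDl.
exists (Num.min d (e / (2 * K))) => /=.
  by rewrite lt_min d0 divr_gt0// mulr_gt0.
move=> h k; rewrite !lt_min => /andP[hd /ltW hh] /andP[kd /ltW kk].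
have E := H h k hd kd.
have E2 : `|u (x + h, y + k) - u (x, y)| <= 1 * (`|h| + `|k|) + (`|ux (x, y)| * `|h| + `|uy (x, y)| * `|k|).
  rewrite -[X in `|X|](subrK (ux (x, y) * h + uy (x, y) * k)).
  rewrite (le_trans (ler_normD _ _))// lerD//.
  by rewrite (le_trans (ler_normD _ _))// !normrM.
apply: le_trans E2 _.
have KK : K * (e / (2 * K)) = e / 2 by field; rewrite gt_eqF.
have -> : e = K * (e / (2 * K)) + K * (e / (2 * K)) by rewrite KK; lra.
rewrite [X in X <= _](_ : _ = (1 + `|ux (x, y)|) * `|h| + (1 + `|uy (x, y)|) * `|k|); last by ring.
apply: lerD; apply: ler_pM => //; rewrite /K ?addr_ge0// ?lerDl// -addrA lerD2l lerDr//.
Qed.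

(** The curves are those along which a dilation about a point moves. *)
Lemma partials_line u ux uy : partials u ux uy ->
  continuous ux -> continuous uy -> forall (a b c d t : R),
  is_derive t 1 (fun s : R => u (a + s * c, b + s * d))
    (c * ux (a + t * c, b + t * d) + d * uy (a + t * c, b + t * d)).
Proof.
move=> uP cx cy a b c d t.
set x := a + t * c; set y := b + t * d.
set D := (X in is_derive _ _ _ X).
suff : (fun h : R => h^-1 *: (((fun s : R => u (a + s * c, b + s * d)) \o shift t) (h *: (1 : R))
   - u (a + t * c, b + t * d))) @ 0^' --> D.
  move=> cD; apply: DeriveDef; first by apply/cvg_ex; exists D.
  by apply: cvg_lim.
apply/cvgrPdist_le => e e0.
pose K := 1 + `|c| + `|d|.
have K0 : 0 < K by rewrite /K -addrA ltr_pwDl.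
have [r r0 H] := partials_increment uP cx cy x y (divr_gt0 e0 K0).
apply/nbhs_ballP; exists (r / K) => /=; first by rewrite divr_gt0.
move=> h; rewrite -ball_normE/= sub0r normrN => hr h0.
have hK : `|h| * K < r by rewrite -ltr_pdivlMr.
have := H (h * c) (h * d).
have -> : `|h * c| < r.
  by rewrite normrM (le_lt_trans _ hK)// ler_wpM2l// /K addrAC lerDr addr_ge0.
have -> : `|h * d| < r.
  by rewrite normrM (le_lt_trans _ hK)// ler_wpM2l// /K lerDr addr_ge0.
move=> /(_ isT isT) E.
have -> : D - h^-1 *: (u (a + (h *: (1:R) + t) * c, b + (h *: (1:R) + t) * d) - u (x, y)) =
   - (h^-1 * (u (x + h * c, y + h * d) - u (x, y) - (ux (x, y) * (h * c) + uy (x, y) * (h * d)))).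
  have -> : a + (h *: (1:R) + t) * c = x + h * c by rewrite /x /GRing.scale/=; ring.
  have -> : b + (h *: (1:R) + t) * d = y + h * d by rewrite /y /GRing.scale/=; ring.
  by rewrite /D /GRing.scale/= -/x -/y; field.
rewrite normrN normrM normfV ler_pdivrMl ?normr_gt0//.
apply: le_trans E _.
rewrite !normrM -mulrDr mulrC -mulrA ler_wpM2l// mulrA.
rewrite ler_pdivrMr// mulrC ler_wpM2l ?(ltW e0)//.
by rewrite /K -addrA lerDr.
Qed.

End partials.

(** * Integration of continuous functions on the plane *)

Section plane_measure.
Context {R : realType}.
Notation mplane := (measurableTypeR R * measurableTypeR R)%type.
Notation leb := (@lebesgue_measure R).
Implicit Types (f k : R * R -> R).

(** An open set is the union of the rational balls that it contains. *)
Lemma open_plane_measurable (A : set (R * R)) : open A ->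
  measurable (A : set mplane).
Proof.
move=> oA.
pose B (q : rat * rat * rat) : set (R * R) :=
  ball (ratr q.1.1 : R) (ratr q.2) `*` ball (ratr q.1.2 : R) (ratr q.2).
pose F q : set mplane := if `[< B q `<=` A >] then B q else set0.
have -> : A = \bigcup_q F q.
  apply/seteqP; split => [[x y] Axy|z [q _]]; last first.
    by rewrite /F; case: asboolP => // BA Bz; exact: BA.
  have /(@nbhs_ballP R (R * R)%type)[e /= e0 eA] : nbhs ((x, y) : R * R) A.
    exact: (open_nbhs_nbhs (conj oA Axy)).
  have [q /= qe] := rat_in_itvoo (divr_gt0 e0 (ltr0n _ 4)).
  move: qe; rewrite in_itv/= => /andP[q0 qe].
  have rx (t : R) : exists p : rat, `|ratr p - t| < ratr q.
    have tq : t < t + ratr q by rewrite ltrDl.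
    have [p] := rat_in_itvoo tq; rewrite in_itv/= => /andP[tp pq].
    by exists p; rewrite ger0_norm ?subr_ge0 ?(ltW tp)// ltrBlDl.
  have [a ax] := rx x; have [b yb] := rx y.
  exists (a, b, q) => //; rewrite /F; case: asboolP => [_|[]].
    by split; rewrite -ball_normE.
  move=> [s t] [/=]; rewrite -!ball_normE/= => sa tb; apply: eA.
  have H (u v w : R) : `|v - u| < ratr q -> `|v - w| < ratr q -> `|u - w| < e.
    move=> vu vw; rewrite -(subrKA v) (le_lt_trans (ler_normD _ _))// distrC.
    by have : 0 < e by []; lra.
  by split => /=; rewrite -ball_normE/=; [exact: H ax sa|exact: H yb tb].
apply: countable_bigcupT_measurable; first exact: countableP.
move=> q; rewrite /F; case: asboolP => _ //.
by apply: measurableX; exact: measurable_ball.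
Qed.

Lemma continuous_plane_measurable f : continuous f ->
  measurable_fun setT (f : mplane -> R).
Proof.
move=> /continuousP cf mT.
apply: (measurability _ (RGenOpens.measurableE R)) => //.
move=> _ [_ [a [b ->] <-]]; rewrite setTI.
apply: open_plane_measurable; apply: cf; exact: interval_open.
Qed.

Lemma continuous_plane_bounded f (N : R) : continuous f ->
  exists2 K : R, 0 < K &
    forall x y, `|x| <= N -> `|y| <= N -> `|f (x, y)| <= K.
Proof.
move=> cf; have cN := compact_setX (@segment_compact R (- N) N) (@segment_compact R (- N) N).
have /compact_bounded[M [_ MM]] := continuous_compact (continuous_subspaceT cf) cN.
exists (`|M| + 1) => // x y xN yN; apply: MM; first by rewrite ltr_pwDr// ler_norm.
by exists (x, y) => //; split => /=; rewrite in_itv/= -ler_norml.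
Qed.

Definition vanishes_outside (N : R) f :=
  forall x y, N <= `|x| \/ N <= `|y| -> f (x, y) = 0.

Definition box (N : R) : set mplane := `[- N, N] `*` `[- N, N].

Lemma measurable_box N : measurable (box N).
Proof. by apply: measurableX. Qed.

Lemma area_box_fin N : (@area R (box N) < +oo)%E.
Proof.
rewrite /area /box product_measure1E//= lebesgue_measure_itv/=.
by case: ifPn => _; rewrite ?mul0e// -EFinD -EFinM ltry.
Qed.

Lemma integrable_vanishing f N : continuous f -> vanishes_outside N f ->
  (@area R).-integrable setT (EFin \o f).
Proof.
move=> cf vf; have [K K0 fK] := continuous_plane_bounded N cf.
have fE : f = f \_ (box N).
  apply/funext => -[x y]; rewrite patchE; case: ifPn => //.
  rewrite notin_setE => /not_andP/=; rewrite !in_itv/= -!ler_norml => H.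
  by rewrite vf//; case: H => /negP; rewrite -ltNge => /ltW; [left|right].
rewrite fE -restrict_EFin; apply/integrable_restrict => //.
  exact: measurable_box.
rewrite setTI; apply: measurable_bounded_integrable.
- exact: measurable_box.
- exact: area_box_fin.
- by apply: measurable_funTS; exact: continuous_plane_measurable.
- exists K; split; first by rewrite num_real.
  move=> r Kr [x y] [/=]; rewrite !in_itv/= -!ler_norml => xN yN.
  exact: le_trans (fK _ _ xN yN) (ltW Kr).
Qed.

Lemma integral_derivative_eq0 (f f' : R -> R) (N : R) : 0 < N ->
  (forall x : R, is_derive x 1 f (f' x)) -> continuous f' ->
  (forall x, N <= `|x| -> f x = 0) -> (forall x, N <= `|x| -> f' x = 0) ->
  (\int[leb]_x (f' x)%:E = 0)%E.
Proof.
move=> N0 fd cf' f0 f'0.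
have -> : (\int[leb]_x (f' x)%:E = \int[leb]_(x in `[(- N)%R, N]) (f' x)%:E)%E.
  rewrite [RHS]integral_mkcond; apply: eq_integral => x _.
  rewrite restrict_EFin/= patchE; case: ifPn => //.
  rewrite notin_setE/= in_itv/= -ler_norml => /negP; rewrite -ltNge => /ltW.
  by move=> /f'0 ->.
have cf (x : R) : {for x, continuous f}.
  apply: differentiable_continuous; apply/derivable1_diffP.
  exact: (@ex_derive _ _ _ _ _ _ _ (fd x)).
rewrite (@continuous_FTC2 _ f' f).
- by rewrite !f0 ?normrN ?ger0_norm ?(ltW N0)// subee.
- by rewrite -subr_gt0 opprK addr_gt0.
- exact: continuous_subspaceT.
- split.
  + by move=> x _; exact: (@ex_derive _ _ _ _ _ _ _ (fd x)).
  + by apply: cvg_at_right_filter; exact: cf.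
  + by apply: cvg_at_left_filter; exact: cf.
- by move=> x _; rewrite derive1E (@derive_val _ _ _ _ _ _ _ (fd x)).
Qed.

Lemma continuous_section1 f (y : R) : continuous f ->
  continuous (fun x : R => f (x, y)).
Proof.
move=> cf x; apply: (@continuous_comp _ _ _ (fun x : R => (x, y)) f); last exact: cf.
exact: (cvg_pair cvg_id (cvg_cst y)).
Qed.

Lemma continuous_section2 f (x : R) : continuous f ->
  continuous (fun y : R => f (x, y)).
Proof.
move=> cf y; apply: (@continuous_comp _ _ _ (fun y : R => (x, y)) f); last exact: cf.
exact: (cvg_pair (cvg_cst x) cvg_id).
Qed.

(** The divergence theorem on the whole plane, where the boundary terms vanish:
    each component is integrated first along its own direction. *)
Lemma integral_divergence (k l kx ly : R * R -> R) (N : R) : 0 < N ->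
  (forall x y : R, is_derive x 1 (fun s : R => k (s, y)) (kx (x, y))) ->
  (forall x y : R, is_derive y 1 (fun s : R => l (x, s)) (ly (x, y))) ->
  continuous kx -> continuous ly ->
  vanishes_outside N k -> vanishes_outside N kx ->
  vanishes_outside N l -> vanishes_outside N ly ->
  (\int[@area R]_z (kx z + ly z) = 0)%R.
Proof.
move=> N0 kP lP ckx cly vk vkx vl vly.
have ik := integrable_vanishing ckx vkx.
have il := integrable_vanishing cly vly.
rewrite RintegralD// /Rintegral.
rewrite -(integral21_prod_meas1 ik) -(integral12_prod_meas1 il)/=.
rewrite !integral0_eq ?addr0// => t _.
- rewrite /fubini_F/=.
  apply: (@integral_derivative_eq0 (fun s => l (t, s)) _ N N0 (lP t)).
  + exact: continuous_section2.
  + by move=> s sN; rewrite vl//; right.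
  + by move=> s sN; rewrite vly//; right.
- rewrite /fubini_G/=.
  apply: (@integral_derivative_eq0 (fun s => k (s, t)) _ N N0 (kP^~ t)).
  + exact: continuous_section1.
  + by move=> s sN; rewrite vk//; left.
  + by move=> s sN; rewrite vkx//; left.
Qed.

End plane_measure.

(** * Differentiation and continuity of explicit expressions *)

Section calculus_rules.
Context {R : realType}.
Implicit Types (f g : R -> R) (x a b : R).

Lemma is_derive_addE f g x a b : is_derive x 1 f a -> is_derive x 1 g b ->
  is_derive x 1 (fun s => f s + g s) (a + b).
Proof. by move=> ? ?; exact: is_deriveD. Qed.

Lemma is_derive_oppE f x a : is_derive x 1 f a ->
  is_derive x 1 (fun s => - f s) (- a).
Proof. by move=> ?; exact: is_deriveN. Qed.

Lemma is_derive_mulE f g x a b : is_derive x 1 f a -> is_derive x 1 g b ->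
  is_derive x 1 (fun s => f s * g s) (f x * b + g x * a).
Proof. by move=> ? ?; exact: is_deriveM. Qed.

Lemma is_derive_expE f n x a : is_derive x 1 f a ->
  is_derive x 1 (fun s => f s ^+ n) (n%:R * f x ^+ n.-1 * a).
Proof.
move=> fd; have -> : (fun s => f s ^+ n) = f ^+ n.
  by apply/funext => s; rewrite exprfctE.
exact: is_deriveX.
Qed.

Lemma is_derive_compE f g x a b : is_derive (g x) 1 f a -> is_derive x 1 g b ->
  is_derive x 1 (fun s => f (g s)) (a * b).
Proof. by move=> ? ?; exact: is_derive1_comp. Qed.

Lemma is_derive_constE x a : is_derive x 1 (fun _ : R => a) 0.
Proof. exact: is_derive_cst. Qed.

Lemma is_derive_idE x : is_derive x 1 (fun s : R => s) 1.
Proof. exact: is_derive_id. Qed.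

Context {T : topologicalType}.
Implicit Types (u v : T -> R).

Lemma continuous_addE u v : continuous u -> continuous v ->
  continuous (fun z => u z + v z).
Proof. by move=> cu cv z; apply: cvgD; [exact: cu|exact: cv]. Qed.

Lemma continuous_oppE u : continuous u -> continuous (fun z => - u z).
Proof. by move=> cu z; apply: cvgN; exact: cu. Qed.

Lemma continuous_mulE u v : continuous u -> continuous v ->
  continuous (fun z => u z * v z).
Proof. by move=> cu cv z; apply: cvgM; [exact: cu|exact: cv]. Qed.

Lemma continuous_expE u n : continuous u -> continuous (fun z => u z ^+ n).
Proof.
move=> cu; elim: n => [|n IH]; first by move=> z; exact: cvg_cst.
by under eq_fun do rewrite exprS; exact: continuous_mulE.
Qed.

Lemma continuous_compE f u : continuous f -> continuous u ->
  continuous (fun z => f (u z)).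
Proof. by move=> cf cu z; apply: continuous_comp; [exact: cu|exact: cf]. Qed.

Lemma continuous_pairE (p : R * R -> R) u v : continuous p -> continuous u ->
  continuous v -> continuous (fun z => p (u z, v z)).
Proof.
move=> cp cu cv z; apply: (@continuous_comp _ _ _ (fun z => (u z, v z)) p).
  exact: (cvg_pair (cu z) (cv z)).
exact: cp.
Qed.

Lemma continuous_cstE (a : R) : continuous (fun _ : T => a).
Proof. by move=> z; exact: cvg_cst. Qed.

End calculus_rules.

Section plane_projections.
Context {R : realType}.

Lemma continuous_fstE : continuous (fun z : R * R => z.1).
Proof. by move=> z; exact: cvg_fst. Qed.

Lemma continuous_sndE : continuous (fun z : R * R => z.2).
Proof. by move=> z; exact: cvg_snd. Qed.

Lemma continuous_idE : continuous (fun z : R => z).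
Proof. by move=> z; exact: cvg_id. Qed.

Lemma continuous_sinE : continuous (@sin R).
Proof. exact: continuous_sin. Qed.

Lemma continuous_cosE : continuous (@cos R).
Proof. exact: continuous_cos. Qed.

Lemma continuous_expRE : continuous (@expR R).
Proof. exact: continuous_expR. Qed.

End plane_projections.

(** Derivatives of explicit expressions, by recursion on their structure; the
    rules are applied by unification only, since is_derive is a class and
    instance search on open goals would commit too early. *)
Ltac der := lazymatch goal with
  | |- is_derive _ _ (fun s => s) _ => exact: is_derive_idE
  | |- is_derive _ _ (fun _ => ?a) _ => exact: is_derive_constE
  | |- is_derive _ _ (fun s => @?f s + @?g s) _ =>
      notypeclasses refine (@is_derive_addE _ f g _ _ _ _ _); [der|der]
  | |- is_derive _ _ (fun s => - @?f s) _ =>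
      notypeclasses refine (@is_derive_oppE _ f _ _ _); der
  | |- is_derive _ _ (fun s => @?f s * @?g s) _ =>
      notypeclasses refine (@is_derive_mulE _ f g _ _ _ _ _); [der|der]
  | |- is_derive _ _ (fun s => @?f s ^+ ?n) _ =>
      notypeclasses refine (@is_derive_expE _ f n _ _ _); der
  | |- is_derive _ _ (fun s => expR (@?f s)) _ =>
      notypeclasses refine (@is_derive_compE _ expR f _ _ _ (is_derive_expR _) _); der
  | |- is_derive _ _ (fun s => cos (@?f s)) _ =>
      notypeclasses refine (@is_derive_compE _ cos f _ _ _ (is_derive_cos _) _); der
  | |- is_derive _ _ (fun s => sin (@?f s)) _ =>
      notypeclasses refine (@is_derive_compE _ sin f _ _ _ (is_derive_sin _) _); der
  | |- is_derive _ _ (fun s => ?W (@?f s)) _ =>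
      first [eassumption|match goal with H : forall s : _, is_derive s _ W _ |- _ =>
      notypeclasses refine (@is_derive_compE _ W f _ _ _ (H _) _); der end]
  | |- _ => idtac
  end.

Ltac derive_ring := notypeclasses refine (is_derive_eq _ _);
  [der|rewrite /=; ring].

Ltac cont := lazymatch goal with
  | |- continuous (fun z => z) => exact: continuous_idE
  | |- continuous (fun z => z.1) => exact: continuous_fstE
  | |- continuous (fun z => z.2) => exact: continuous_sndE
  | |- continuous (fun _ => ?a) => exact: continuous_cstE
  | |- continuous (fun s => @?f s + @?g s) =>
      apply: (@continuous_addE _ _ f g); [cont|cont]
  | |- continuous (fun s => - @?f s) => apply: (@continuous_oppE _ _ f); cont
  | |- continuous (fun s => @?f s * @?g s) =>
      apply: (@continuous_mulE _ _ f g); [cont|cont]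
  | |- continuous (fun s => @?f s ^+ ?n) =>
      apply: (@continuous_expE _ _ f n); cont
  | |- continuous (fun s => expR (@?f s)) =>
      apply: (@continuous_compE _ _ expR f); [exact: continuous_expRE|cont]
  | |- continuous (fun s => cos (@?f s)) =>
      apply: (@continuous_compE _ _ cos f); [exact: continuous_cosE|cont]
  | |- continuous (fun s => sin (@?f s)) =>
      apply: (@continuous_compE _ _ sin f); [exact: continuous_sinE|cont]
  | |- continuous (fun s => ?p (@?f s, @?g s)) =>
      apply: (@continuous_pairE _ _ p f g); [try done|cont|cont]
  | |- continuous (fun s => ?p (@?f s)) =>
      first [assumption|apply: (@continuous_compE _ _ p f); [try done|cont]]
  | |- _ => try done
  end.

(** * Holomorphic pairs and their weighted means *)

Section holomorphic_pairs.
Context {R : realType}.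
Implicit Types (P Q p q : R * R -> R) (c v z : R * R).

(** P + i Q is holomorphic with derivative p + i q; the Cauchy-Riemann equations
    are built into the sharing of p and q. *)
Definition holo P Q p q : Prop :=
  [/\ partials P p (fun z => - q z), partials Q q p, continuous p & continuous q].

Lemma holo_continuous P Q p q : holo P Q p q -> continuous P /\ continuous Q.
Proof.
move=> [dP dQ cp cq]; split; last exact: partials_continuous dQ cq cp.
apply: partials_continuous dP cp _; cont.
Qed.

Lemma holo_mul P Q p q P' Q' p' q' : holo P Q p q -> holo P' Q' p' q' ->
  holo (fun z => P z * P' z - Q z * Q' z) (fun z => P z * Q' z + Q z * P' z)
    (fun z => P z * p' z - Q z * q' z + (p z * P' z - q z * Q' z))
    (fun z => P z * q' z + Q z * p' z + (p z * Q' z + q z * P' z)).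
Proof.
move=> h h'; have [cP cQ] := holo_continuous h; have [cP' cQ'] := holo_continuous h'.
case: h h' => [dP dQ cp cq] [dP' dQ' cp' cq']; split.
- move=> x y; have [Px Py] := dP x y; have [Qx Qy] := dQ x y.
  have [Px' Py'] := dP' x y; have [Qx' Qy'] := dQ' x y.
  by split; derive_ring.
- move=> x y; have [Px Py] := dP x y; have [Qx Qy] := dQ x y.
  have [Px' Py'] := dP' x y; have [Qx' Qy'] := dQ' x y.
  by split; derive_ring.
- cont.
- cont.
Qed.

Lemma holo_cst (a b : R) :
  holo (fun _ => a) (fun _ => b) (fun _ => 0) (fun _ => 0).
Proof.
split; try exact: continuous_cstE.
- by move=> x y; split; [exact: is_derive_constE|rewrite oppr0; exact: is_derive_constE].
- by move=> x y; split; exact: is_derive_constE.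
Qed.

(** This is exp ((a + i b) (z - c)). *)
Lemma holo_exp (a b : R) c :
  let A z := a * (z.1 - c.1) - b * (z.2 - c.2) in
  let B z := a * (z.2 - c.2) + b * (z.1 - c.1) in
  let E z := expR (A z) * cos (B z) in
  let F z := expR (A z) * sin (B z) in
  holo E F (fun z => a * E z - b * F z) (fun z => a * F z + b * E z).
Proof.
move=> A B E F; rewrite /E /F /A /B; split; last 2 first.
- cont.
- cont.
- by move=> x y; split; rewrite /=; derive_ring.
- by move=> x y; split; rewrite /=; derive_ring.
Qed.

Definition sqdist c z : R := (z.1 - c.1) ^+ 2 + (z.2 - c.2) ^+ 2.

Lemma sqdist_ge0 c z : 0 <= sqdist c z.
Proof. by rewrite addr_ge0// sqr_ge0. Qed.

Lemma sqdist_ge c (r x y : R) : 0 <= r ->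
  `|c.1| + `|c.2| + r <= `|x| \/ `|c.1| + `|c.2| + r <= `|y| ->
  r ^+ 2 <= sqdist c (x, y).
Proof.
move=> r0 H; rewrite /sqdist /=.
have S (s t : R) : r <= `|s| -> r ^+ 2 <= s ^+ 2.
  by move=> rs; rewrite -(real_normK (num_real s)) lerXn2r ?nnegrE.
have T (s t : R) : `|t| + r <= `|s| -> r <= `|s - t|.
  by move=> ts; have := lerB_dist s t; lra.
case: H => H.
  rewrite -[X in X <= _]addr0 lerD ?sqr_ge0// S// T// (le_trans _ H)//.
  by rewrite -addrA lerD2l lerDr.
rewrite -[X in X <= _]add0r lerD ?sqr_ge0// S// T// (le_trans _ H)//.
by rewrite -addrA lerDr.
Qed.

(** W is the profile of a radial weight around c, supported in the disc of
    radius r. *)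
Section mean_value.
Variables (W W' : R -> R) (r : R) (c : R * R).
Hypotheses (r0 : 0 < r) (dW : forall s : R, is_derive s 1 W (W' s)).
Hypotheses (cW' : continuous W').
Hypotheses (W0 : forall s, r ^+ 2 <= s -> W s = 0).
Hypotheses (W'0 : forall s, r ^+ 2 <= s -> W' s = 0).

Let N := `|c.1| + `|c.2| + r.

Let N0 : 0 < N. Proof. by rewrite ltr_wpDl// addr_ge0. Qed.

Let cW : continuous W.
Proof.
move=> s; apply: differentiable_continuous; apply/derivable1_diffP.
exact: (@ex_derive _ _ _ _ _ _ _ (dW s)).
Qed.

Let cWc : continuous (fun v => W (sqdist c v)).
Proof. rewrite /sqdist; cont. Qed.

Lemma vanishes_bump (g : R * R -> R) :
  vanishes_outside N (fun v => W (sqdist c v) * g v).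
Proof. by move=> x y xy; rewrite W0 ?mul0r// sqdist_ge// ltW. Qed.

Lemma integrable_bump (g : R * R -> R) : continuous g ->
  (@area R).-integrable setT (EFin \o (fun v => W (sqdist c v) * g v)).
Proof.
by move=> cg; apply: (@integrable_vanishing _ _ N) (vanishes_bump g); exact: continuous_mulE.
Qed.

Let dil (t : R) v : R * R := (c.1 + t * (v.1 - c.1), c.2 + t * (v.2 - c.2)).

Let cdil (g : R * R -> R) t : continuous g -> continuous (fun v => g (dil t v)).
Proof. by move=> cg; rewrite /dil; cont. Qed.

(** By the Cauchy-Riemann equations the infinitesimal dilation of P is the
    infinitesimal rotation of Q.  A rotation field is divergence free and tangent
    to the circles on which the weight is constant. *)
Lemma radial_dilation_eq0 P Q p q (t : R) : holo P Q p q -> t != 0 ->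
  (\int[@area R]_v (W (sqdist c v) *
    ((v.1 - c.1) * p (dil t v) - (v.2 - c.2) * q (dil t v))) = 0)%R.
Proof.
move=> h t0; have [cP cQ] := holo_continuous h.
case: h => [dP dQ cp cq].
have cpt := @cdil _ t cp; have cqt := @cdil _ t cq; have cQt := @cdil _ t cQ.
(* (k, l) is the rotation field times the weight and the dilated Q *)
pose k v := - (v.2 - c.2) * (W (sqdist c v) * Q (dil t v)).
pose l v := (v.1 - c.1) * (W (sqdist c v) * Q (dil t v)).
pose kx v := - (v.2 - c.2) * (W' (sqdist c v) * (2 * (v.1 - c.1)) * Q (dil t v)
  + W (sqdist c v) * (t * q (dil t v))).
pose ly v := (v.1 - c.1) * (W' (sqdist c v) * (2 * (v.2 - c.2)) * Q (dil t v)
  + W (sqdist c v) * (t * p (dil t v))).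
have cW'c : continuous (fun v => W' (sqdist c v)) by rewrite /sqdist; cont.
have S x y : N <= `|x| \/ N <= `|y| -> r ^+ 2 <= sqdist c (x, y).
  by move=> xy; rewrite sqdist_ge// ltW.
have : (\int[@area R]_v (kx v + ly v) = 0)%R.
  apply: (@integral_divergence _ k l kx ly N N0).
  - move=> x y; rewrite /k /kx /sqdist /dil/=.
    have HQ := (dQ (c.1 + t * (x - c.1)) (c.2 + t * (y - c.2))).1.
    notypeclasses refine (is_derive_eq _ _).
      notypeclasses refine (@is_derive_mulE _ _ _ _ _ _ _ _); first der.
      notypeclasses refine (@is_derive_mulE _ _ _ _ _ _ _ _); first der.
      notypeclasses refine (@is_derive_compE _ (fun s => Q (s, c.2 + t * (y - c.2))) (fun s => c.1 + t * (s - c.1)) _ _ _ HQ _); der.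
    by rewrite /=; ring.
  - move=> x y; rewrite /l /ly /sqdist /dil/=.
    have HQ := (dQ (c.1 + t * (x - c.1)) (c.2 + t * (y - c.2))).2.
    notypeclasses refine (is_derive_eq _ _).
      notypeclasses refine (@is_derive_mulE _ _ _ _ _ _ _ _); first der.
      notypeclasses refine (@is_derive_mulE _ _ _ _ _ _ _ _); first der.
      notypeclasses refine (@is_derive_compE _ (fun s => Q (c.1 + t * (x - c.1), s)) (fun s => c.2 + t * (s - c.2)) _ _ _ HQ _); der.
    by rewrite /=; ring.
  - rewrite /kx; cont.
  - rewrite /ly; cont.
  - by move=> x y xy; rewrite /k W0 ?mul0r ?mulr0//; exact: S.
  - by move=> x y xy; rewrite /kx W0 ?W'0 ?mul0r ?addr0 ?mulr0//; exact: S.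
  - by move=> x y xy; rewrite /l W0 ?mul0r ?mulr0//; exact: S.
  - by move=> x y xy; rewrite /ly W0 ?W'0 ?mul0r ?addr0 ?mulr0//; exact: S.
pose g v := W (sqdist c v) *
    ((v.1 - c.1) * p (dil t v) - (v.2 - c.2) * q (dil t v)).
have -> : (fun v => kx v + ly v) = (fun v => t * g v).
  by apply/funext => v; rewrite /kx /ly /g; ring.
rewrite RintegralZl//; last first.
  by apply: integrable_bump; cont.
by move=> /eqP; rewrite mulf_eq0 (negPf t0) => /eqP.
Qed.

(** The weighted mean M(t) of v |-> P(c + t (v - c)) has derivative zero for
    t <> 0; M(0) and M(1) are the two sides. *)
Lemma mean_value P Q p q : holo P Q p q ->
  (\int[@area R]_v (W (sqdist c v) * P v) =
   P c * \int[@area R]_v W (sqdist c v))%R.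
Proof.
move=> h; have [cP cQ] := holo_continuous h; case: (h) => [dP dQ cp cq].
pose f t v := W (sqdist c v) * P (dil t v).
pose M t := (\int[@area R]_v f t v)%R.
pose g t v := (v.1 - c.1) * p (dil t v) - (v.2 - c.2) * q (dil t v).
have df (t : R) v : is_derive t 1 (f ^~ v) (W (sqdist c v) * g t v).
  rewrite /f /dil/=; notypeclasses refine (is_derive_eq _ _).
    notypeclasses refine (@is_derive_mulE _ _ _ _ _ _ _ _); first der.
    have cNq : continuous (fun z => - q z) by cont.
    exact: (partials_line dP cp cNq c.1 c.2 (v.1 - c.1) (v.2 - c.2) t).
  by rewrite /g /=; ring.
have d1f (t : R) v : partial1of2 f t v = W (sqdist c v) * g t v.
  by rewrite partial1of2E (@derive_val _ _ _ _ _ _ _ (df t v)).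
have [K1 K10 Kp] := continuous_plane_bounded (N + 2 * r) cp.
have [K2 K20 Kq] := continuous_plane_bounded (N + 2 * r) cq.
pose G v := `|W (sqdist c v) * (r * (K1 + K2))|.
have intG : (@area R).-integrable setT (EFin \o G).
  have := @integrable_bump (fun _ => r * (K1 + K2)) (@continuous_cstE _ _ _).
  by move=> /integrable_abse; apply: eq_integrable.
have G_ge0 v : 0 <= G v by exact: normr_ge0.
have derf (s : R) v : derivable (f ^~ v) s 1.
  exact: (@ex_derive _ _ _ _ _ _ _ (df s v)).
have G_ub (t : R) v : `]-2, 2[%classic t -> `|partial1of2 f t v| <= G v.
  rewrite /= in_itv/= => /andP[t1 t2]; rewrite d1f /G.
  have [rv|vr] := leP (r ^+ 2) (sqdist c v); first by rewrite W0// !mul0r.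
  rewrite !normrM ler_wpM2l//.
  have t2' : `|t| <= 2 by rewrite ler_norml; lra.
  have H (a b : R) : a ^+ 2 + b ^+ 2 < r ^+ 2 -> `|a| <= r.
    move=> ab; rewrite -(@ler_pXn2r _ 2)// ?nnegrE ?ltW// real_normK ?num_real//.
    by have := sqr_ge0 b; lra.
  have a1 : `|v.1 - c.1| <= r by apply: H vr.
  have a2 : `|v.2 - c.2| <= r by apply: (H _ (v.1 - c.1)); rewrite addrC.
  have B (ci a : R) : `|ci| <= `|c.1| + `|c.2| -> `|a| <= r ->
      `|ci + t * a| <= N + 2 * r.
    move=> cic ar; rewrite (le_trans (ler_normD _ _))// normrM.
    have ta : `|t| * `|a| <= 2 * r by apply: ler_pM.
    by rewrite lerD// (le_trans cic)// lerDl ltW.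
  rewrite (ger0_norm (ltW r0)) (ger0_norm (ltW (addr_gt0 K10 K20))).
  rewrite /g (le_trans (ler_normB _ _))// mulrDr !normrM.
  have C1 : `|c.1 + t * (v.1 - c.1)| <= N + 2 * r by apply: B => //; rewrite lerDl.
  have C2 : `|c.2 + t * (v.2 - c.2)| <= N + 2 * r by apply: B => //; rewrite lerDr.
  by rewrite lerD// ler_pM//; [apply: Kp|apply: Kq].
have intf (t : R) : (@area R).-integrable setT (EFin \o f t).
  by apply: integrable_bump; exact: cdil.
have dM (t : R) : t \in `]-2, 2[ -> is_derive t 1 M (\int[@area R]_v (W (sqdist c v) * g t v))%R.
  move=> t2; apply: DeriveDef.
    apply: (@derivable_under_integral _ _ _ (@area R) f setT measurableT t (-2) 2 _ _ _ G) => //;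
      try by move=> s v s2 _; exact: G_ub.
  rewrite -derive1E.
  rewrite (@differentiation_under_integral _ _ _ (@area R) f setT measurableT t (-2) 2 _ _ _ G) => //;
      try by move=> s v s2 _; exact: G_ub.
  by apply: eq_Rintegral => v _; rewrite d1f.
have x2 (x : R) : 0 <= x <= 1 -> x \in `]-2, 2[ by rewrite in_itv/=; lra.
pose dMt (t : R) := (\int[@area R]_v (W (sqdist c v) * g t v))%R.
have dM01 (x : R) : x \in `]0, 1[ -> is_derive x 1 M (dMt x).
  by rewrite in_itv/= => /andP[/ltW x0 /ltW x1]; apply: dM; apply: x2; rewrite x0.
have cM : {within `[0, 1], continuous M}.
  apply: derivable_within_continuous => x; rewrite in_itv/= => /x2 /dM dx.
  exact: (@ex_derive _ _ _ _ _ _ _ dx).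
have [x x01] := MVT ltr01 dM01 cM.
rewrite /dMt (radial_dilation_eq0 h) ?mul0r; last first.
  by move: x01; rewrite in_itv/= => /andP[/lt0r_neq0].
move=> /eqP; rewrite subr_eq0 => /eqP; rewrite /M /f.
have -> : (fun v => W (sqdist c v) * P (dil 1 v)) = (fun v => W (sqdist c v) * P v).
  by apply/funext => v; rewrite /dil !mul1r !subrKC -surjective_pairing.
move=> ->.
have -> : (fun v => W (sqdist c v) * P (dil 0 v)) = (fun v => P c * (W (sqdist c v) * 1)).
  by apply/funext => v; rewrite /dil !mul0r !addr0 -surjective_pairing mulr1 mulrC.
rewrite RintegralZl//; last by apply: integrable_bump; exact: continuous_cstE.
by congr (_ * _); apply: eq_Rintegral => v _; rewrite mulr1.
Qed.

End mean_value.
End holomorphic_pairs.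

(** * Harmonic conjugates *)

Section harmonic_conjugate.
Context {R : realType}.
Notation leb := (@lebesgue_measure R).
Implicit Types (u F : R * R -> R) (z : R * R).

Lemma integrable_segment (g : R -> R) : continuous g ->
  leb.-integrable `[0, 1] (EFin \o g).
Proof.
move=> cg; apply: continuous_compact_integrable; first exact: segment_compact.
exact: continuous_subspaceT.
Qed.

Lemma derive_segment_integral (F Fx : R * R -> R) :
  (forall x s : R, is_derive x 1 (fun t : R => F (t, s)) (Fx (x, s))) ->
  continuous F -> continuous Fx -> forall x : R,
  is_derive x 1 (fun t => \int[leb]_(s in `[0, 1]) F (t, s))%R
    (\int[leb]_(s in `[0, 1]) Fx (x, s))%R.
Proof.
move=> dF cF cFx x0.
have [K K0 FK] := continuous_plane_bounded (`|x0| + 1) cFx.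
pose f (t s : R) := F (t, s).
have d1f (t s : R) : partial1of2 f t s = Fx (t, s).
  by rewrite partial1of2E (@derive_val _ _ _ _ _ _ _ (dF t s)).
have derf (t s : R) : derivable (f ^~ s) t 1.
  exact: (@ex_derive _ _ _ _ _ _ _ (dF t s)).
have intf (t : R) : leb.-integrable `[0, 1] (EFin \o f t).
  by apply: integrable_segment; exact: continuous_section2.
have intG : leb.-integrable `[0, 1] (EFin \o (fun=> K)).
  by apply: integrable_segment; exact: continuous_cstE.
have x0I : `](x0 - 1), (x0 + 1)[%classic x0 by rewrite /= in_itv/=; lra.
have Gub (t s : R) : `](x0 - 1), (x0 + 1)[%classic t -> `[0, 1]%classic s ->
    `|partial1of2 f t s| <= K.
  rewrite /= !in_itv/= d1f => /andP[t1 t2] /andP[s1 s2]; apply: FK.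
    rewrite -(subrKC x0 t) (le_trans (ler_normD _ _))// lerD2l ler_norml; lra.
  by rewrite ger0_norm// (le_trans s2)// lerDr.
apply: DeriveDef.
  by apply: (@derivable_under_integral _ _ _ leb f `[0, 1] _ x0 (x0 - 1) (x0 + 1) _ _ _ (fun=> K)) => // ?; exact: ltW.
rewrite -derive1E.
rewrite (@differentiation_under_integral _ _ _ leb f `[0, 1] _ x0 (x0 - 1) (x0 + 1) _ _ _ (fun=> K)) //.
- by apply: eq_Rintegral => s _; rewrite d1f.
- by move=> ?; exact: ltW.
Qed.

Lemma segment_FTC (f f' : R -> R) : (forall s : R, is_derive s 1 f (f' s)) ->
  continuous f' -> (\int[leb]_(s in `[0, 1]) f' s)%R = f 1 - f 0.
Proof.
move=> fd cf'.
have cf (x : R) : {for x, continuous f}.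
  apply: differentiable_continuous; apply/derivable1_diffP.
  exact: (@ex_derive _ _ _ _ _ _ _ (fd x)).
rewrite /Rintegral (@continuous_FTC2 _ f' f)//.
- exact: continuous_subspaceT.
- split.
  + by move=> x _; exact: (@ex_derive _ _ _ _ _ _ _ (fd x)).
  + by apply: cvg_at_right_filter; exact: cf.
  + by apply: cvg_at_left_filter; exact: cf.
- by move=> x _; rewrite derive1E (@derive_val _ _ _ _ _ _ _ (fd x)).
Qed.

Lemma partials_ray u ux uy : partials u ux uy -> continuous ux ->
  continuous uy -> forall x y s : R, is_derive s 1 (fun t : R => u (t * x, t * y))
    (x * ux (s * x, s * y) + y * uy (s * x, s * y)).
Proof.
move=> du cx cy x y s; have := partials_line du cx cy 0 0 x y s.
rewrite !add0r; set f := (X in is_derive _ _ X _) => df.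
by have -> : (fun t : R => u (t * x, t * y)) = f by apply/funext => t; rewrite /f !add0r.
Qed.

(** Q is the integral of the conjugate differential along the ray from 0.  When
    it is differentiated under the integral, the Laplace equation turns the
    integrand into the derivative along the ray of - s u_y(s z), for the partial
    derivative in x, and of s u_x(s z), for the partial derivative in y. *)
Lemma conjugate_pair u ux uy uxx uxy uyx uyy :
  partials u ux uy -> partials ux uxx uxy -> partials uy uyx uyy ->
  continuous ux -> continuous uy -> continuous uxx -> continuous uxy ->
  continuous uyx -> continuous uyy -> (forall z, uxx z = - uyy z) ->
  exists Q, Q (0, 0) = 0 /\ holo u Q ux (fun z => - uy z).
Proof.
move=> du dux duy cux cuy cuxx cuxy cuyx cuyy E.
pose Q z := (\int[leb]_(s in `[0, 1]) (z.2 * ux (s * z.1, s * z.2) - z.1 * uy (s * z.1, s * z.2)))%R.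
exists Q; split.
  rewrite /Q /=; rewrite (_ : (fun _ => _) = fun=> 0) ?Rintegral0//; last first.
    by apply/funext => s; rewrite !mul0r subr0.
  by rewrite /Rintegral integral0.
split; last 2 first.
- exact: cux.
- by apply: continuous_oppE.
- by move=> x y; rewrite /= opprK; exact: du.
move=> x y; split.
- pose F z := y * ux (z.2 * z.1, z.2 * y) - z.1 * uy (z.2 * z.1, z.2 * y).
  pose Fx z := y * (uxx (z.2 * z.1, z.2 * y) * z.2) -
    (uy (z.2 * z.1, z.2 * y) + z.1 * (uyx (z.2 * z.1, z.2 * y) * z.2)).
  have -> : (fun t => Q (t, y)) = (fun t => \int[leb]_(s in `[0, 1]) F (t, s))%R by [].
  have dF (t s : R) : is_derive t 1 (fun t : R => F (t, s)) (Fx (t, s)).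
    rewrite /F /Fx /=.
    have H1 := (dux (s * t) (s * y)).1; have H2 := (duy (s * t) (s * y)).1.
    notypeclasses refine (is_derive_eq _ _).
      notypeclasses refine (@is_derive_addE _ _ _ _ _ _ _ _).
        notypeclasses refine (@is_derive_mulE _ _ _ _ _ _ _ _); first der.
        notypeclasses refine (@is_derive_compE _ (fun t => ux (t, s * y)) (fun t => s * t) _ _ _ H1 _); der.
      notypeclasses refine (@is_derive_oppE _ _ _ _ _).
      notypeclasses refine (@is_derive_mulE _ _ _ _ _ _ _ _); first der.
      notypeclasses refine (@is_derive_compE _ (fun t => uy (t, s * y)) (fun t => s * t) _ _ _ H2 _); der.
    by rewrite /=; ring.
  have := @derive_segment_integral F Fx dF _ _ x.
  rewrite (_ : (\int[leb]_(s in `[0, 1]) Fx (x, s))%R = - uy (x, y)).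
    by apply; rewrite /F /Fx; cont.
  pose g s := - (s * uy (s * x, s * y)).
  pose g' s := - (uy (s * x, s * y) + s * (x * uyx (s * x, s * y) + y * uyy (s * x, s * y))).
  have dg (s : R) : is_derive s 1 g (g' s).
    rewrite /g /g'; have H := partials_ray duy cuyx cuyy x y s.
    notypeclasses refine (is_derive_eq _ _).
      notypeclasses refine (@is_derive_oppE _ _ _ _ _).
      notypeclasses refine (@is_derive_mulE _ _ _ _ _ _ _ H); der.
    by rewrite /=; ring.
  have -> : (\int[leb]_(s in `[0, 1]) Fx (x, s) = \int[leb]_(s in `[0, 1]) g' s)%R.
    by apply: eq_Rintegral => s _; rewrite /Fx /g' /= E; ring.
  rewrite (segment_FTC dg); first by rewrite /g !mul1r mul0r oppr0 subr0.
  rewrite /g'; cont.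
- pose F z := z.1 * ux (z.2 * x, z.2 * z.1) - x * uy (z.2 * x, z.2 * z.1).
  pose Fx z := ux (z.2 * x, z.2 * z.1) + z.1 * (uxy (z.2 * x, z.2 * z.1) * z.2)
     - x * (uyy (z.2 * x, z.2 * z.1) * z.2).
  have -> : (fun t => Q (x, t)) = (fun t => \int[leb]_(s in `[0, 1]) F (t, s))%R by [].
  have dF (t s : R) : is_derive t 1 (fun t : R => F (t, s)) (Fx (t, s)).
    rewrite /F /Fx /=.
    have H1 := (dux (s * x) (s * t)).2; have H2 := (duy (s * x) (s * t)).2.
    notypeclasses refine (is_derive_eq _ _).
      notypeclasses refine (@is_derive_addE _ _ _ _ _ _ _ _).
        notypeclasses refine (@is_derive_mulE _ _ _ _ _ _ _ _); first der.
        notypeclasses refine (@is_derive_compE _ (fun t => ux (s * x, t)) (fun t => s * t) _ _ _ H1 _); der.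
      notypeclasses refine (@is_derive_oppE _ _ _ _ _).
      notypeclasses refine (@is_derive_mulE _ _ _ _ _ _ _ _); first der.
      notypeclasses refine (@is_derive_compE _ (fun t => uy (s * x, t)) (fun t => s * t) _ _ _ H2 _); der.
    by rewrite /=; ring.
  have := @derive_segment_integral F Fx dF _ _ y.
  rewrite (_ : (\int[leb]_(s in `[0, 1]) Fx (y, s))%R = ux (x, y)).
    by apply; rewrite /F /Fx; cont.
  pose g s := s * ux (s * x, s * y).
  pose g' s := ux (s * x, s * y) + s * (x * uxx (s * x, s * y) + y * uxy (s * x, s * y)).
  have dg (s : R) : is_derive s 1 g (g' s).
    rewrite /g /g'; have H := partials_ray dux cuxx cuxy x y s.
    notypeclasses refine (is_derive_eq _ _).
      notypeclasses refine (@is_derive_mulE _ _ _ _ _ _ _ H); der.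
    by rewrite /=; ring.
  have -> : (\int[leb]_(s in `[0, 1]) Fx (y, s) = \int[leb]_(s in `[0, 1]) g' s)%R.
    by apply: eq_Rintegral => s _; rewrite /Fx /g' /= E; ring.
  rewrite (segment_FTC dg); first by rewrite /g !mul1r mul0r subr0.
  rewrite /g'; cont.
Qed.

Lemma harmonic_conjugate u : real_harmonic u ->
  exists Q, Q (0, 0) = 0 /\ holo u Q (dx u) (fun z => - dy u z).
Proof.
move=> [[C1u C1x C1y] lap].
have du := C1_partials C1u; have dux := C1_partials C1x; have duy := C1_partials C1y.
case: C1u => _ _ cux cuy; case: C1x => _ _ cuxx cuxy; case: C1y => _ _ cuyx cuyy.
apply: (conjugate_pair du dux duy) => // z.
by apply/eqP; rewrite -addr_eq0 lap.
Qed.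

End harmonic_conjugate.

(** * Radial cutoffs of the Gaussian *)

Section bump_profile.
Context {R : realType}.

Lemma is_derive_quadratic (f : R -> R) (x d : R) :
  (forall h, `|f (x + h) - f x - d * h| <= h ^+ 2) -> is_derive x 1 f d.
Proof.
move=> fd.
suff : (fun h : R => h^-1 *: ((f \o shift x) (h *: (1 : R)) - f x)) @ 0^' --> d.
  by move=> cD; apply: DeriveDef; [apply/cvg_ex; exists d|exact: cvg_lim].
apply/cvgrPdist_le => e e0; apply/nbhs_ballP; exists e => //= h.
rewrite -ball_normE/= sub0r normrN => he h0.
have -> : d - h^-1 *: (f (h *: (1 : R) + x) - f x) = - (h^-1 * (f (x + h) - f x - d * h)).
  have -> : h *: (1 : R) + x = x + h by rewrite /GRing.scale/= mulr1 addrC.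
  by rewrite /GRing.scale/=; field.
rewrite normrN normrM normfV ler_pdivrMl ?normr_gt0//.
apply: le_trans (fd h) _.
by rewrite -(real_normK (num_real h)) expr2 ler_wpM2l// ltW.
Qed.

(** The square of the ramp is continuously differentiable, which is all the
    smoothness that the divergence theorem asks of a cutoff. *)
Definition ramp (s : R) : R := Num.max 0 s.

Lemma ramp_ge0 s : 0 <= ramp s. Proof. by rewrite le_max lexx. Qed.

Lemma ramp0 s : s <= 0 -> ramp s = 0. Proof. by move=> /max_idPl. Qed.

Lemma rampE s : 0 <= s -> ramp s = s. Proof. by move=> /max_idPr. Qed.

Lemma ramp_sqr_derive (s : R) : is_derive s 1 (fun t => ramp t ^+ 2) (2 * ramp s).
Proof.
apply: is_derive_quadratic => h.
have [s0|/ltW s0] := leP 0 s; have [sh0|/ltW sh0] := leP 0 (s + h).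
- by rewrite !rampE// ler_norml; apply/andP; split; nra.
- by rewrite (rampE s0) (ramp0 sh0) ler_norml; apply/andP; split; nra.
- by rewrite (ramp0 s0) (rampE sh0) ler_norml; apply/andP; split; nra.
- by rewrite !ramp0// expr0n/= !mulr0 !mul0r !subr0 normr0 sqr_ge0.
Qed.

Lemma continuous_ramp : continuous ramp.
Proof. by move=> s; apply: continuous_max; [exact: cvg_cst|exact: cvg_id]. Qed.

Variables (b n : R).

Definition bump (s : R) : R := ramp (n ^+ 2 - s) ^+ 2 * expR (- b * s).
Definition bump' (s : R) : R :=
  - (2 * ramp (n ^+ 2 - s) * expR (- b * s) + b * bump s).

Lemma bump_derive (s : R) : is_derive s 1 bump (bump' s).
Proof.
rewrite /bump /bump' /bump; have H := ramp_sqr_derive (n ^+ 2 - s).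
notypeclasses refine (is_derive_eq _ _).
  notypeclasses refine (@is_derive_mulE _ _ _ _ _ _ _ _); last der.
  notypeclasses refine (@is_derive_compE _ (fun t => ramp t ^+ 2) (fun s => n ^+ 2 - s) _ _ _ H _); der.
by rewrite /=; ring.
Qed.

Lemma bump_ge0 s : 0 <= bump s.
Proof. by rewrite mulr_ge0 ?sqr_ge0// expR_ge0. Qed.

Lemma continuous_bump : continuous bump.
Proof. by have cr := continuous_ramp; rewrite /bump; cont. Qed.

Lemma continuous_bump' : continuous bump'.
Proof. by have cr := continuous_ramp; rewrite /bump' /bump; cont. Qed.

Lemma bump0 s : n ^+ 2 <= s -> bump s = 0.
Proof. by move=> ns; rewrite /bump ramp0 ?subr_le0// expr0n/= mul0r. Qed.

Lemma bump'0 s : n ^+ 2 <= s -> bump' s = 0.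
Proof.
by move=> ns; rewrite /bump' bump0// ramp0 ?subr_le0// !(mulr0, mul0r) addr0 oppr0.
Qed.

End bump_profile.

(** * The energy of the conjugate *)

Section weighted_estimates.
Context {R : realType}.
Variable alpha : R.
Notation mplane := (measurableTypeR R * measurableTypeR R)%type.
Implicit Types (u P Q p q : R * R -> R) (c v z : R * R).

Lemma cmod_sqr (z : R[i]) : cmod z ^+ 2 = complex.Re z ^+ 2 + complex.Im z ^+ 2.
Proof. by case: z => x y; rewrite /cmod/= sqr_sqrtr// addr_ge0// sqr_ge0. Qed.

Lemma gaussE : gauss alpha = (fun z => expR (- alpha * (z.1 ^+ 2 + z.2 ^+ 2))).
Proof. by apply/funext => z; rewrite /gauss cmod_sqr. Qed.

Lemma gauss_gt0 z : 0 < gauss alpha z. Proof. exact: expR_gt0. Qed.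

Lemma gauss_ge0 z : 0 <= gauss alpha z. Proof. exact: expR_ge0. Qed.

Lemma continuous_gauss : continuous (gauss alpha).
Proof. by rewrite gaussE; cont. Qed.

Lemma mean_value_bump P Q p q c (n : R) : 0 < n -> holo P Q p q ->
  (\int[@area R]_v (bump alpha n (sqdist c v) * P v) =
   P c * \int[@area R]_v bump alpha n (sqdist c v))%R.
Proof.
move=> n0 h.
exact: (mean_value c n0 (bump_derive alpha n) (@continuous_bump' _ alpha n)
   (@bump0 _ alpha n) (@bump'0 _ alpha n) h).
Qed.

Lemma integrable_bump_profile c (n : R) (g : R * R -> R) : 0 < n -> continuous g ->
  (@area R).-integrable setT (EFin \o (fun v => bump alpha n (sqdist c v) * g v)).
Proof.
move=> n0 cg.
exact: (integrable_bump c n0 (bump_derive alpha n) (@bump0 _ alpha n) cg).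
Qed.

Lemma Rintegral_bump_ge0 c (n : R) :
  0 <= (\int[@area R]_v bump alpha n (sqdist c v))%R.
Proof. by apply: Rintegral_ge0 => v _; exact: bump_ge0. Qed.

Lemma holo_sqr P Q p q : holo P Q p q ->
  exists p' q', holo (fun z => P z ^+ 2 - Q z ^+ 2) (fun z => 2 * (P z * Q z)) p' q'.
Proof.
move=> h; have := holo_mul h h; set p' := (X in holo _ _ X _).
set q' := (X in holo _ _ _ X); exists p', q'.
have -> : (fun z => P z ^+ 2 - Q z ^+ 2) = (fun z => P z * P z - Q z * Q z) by [].
suff -> : (fun z => 2 * (P z * Q z)) = (fun z => P z * Q z + Q z * P z) by [].
by apply/funext => z; rewrite (mulrC (Q z)) mulr_natl mulr2n.
Qed.

(** u^2 - Q^2 is the real part of (u + i Q)^2, hence its weighted mean is a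
    nonnegative multiple of its value u(0)^2 at the centre. *)
Lemma bump_energy u Q p q (n : R) : 0 < n -> holo u Q p q -> Q (0, 0) = 0 ->
  (\int[@area R]_v (bump alpha n (sqdist (0%R, 0%R) v) * Q v ^+ 2) <=
   \int[@area R]_v (bump alpha n (sqdist (0%R, 0%R) v) * u v ^+ 2))%R.
Proof.
move=> n0 h Q0; have [cu cQ] := holo_continuous h.
have [p' [q' h2]] := holo_sqr h.
have iu : (@area R).-integrable setT (EFin \o (fun v => bump alpha n (sqdist (0%R, 0%R) v) * u v ^+ 2)).
  by apply: integrable_bump_profile => //; cont.
have iQ : (@area R).-integrable setT (EFin \o (fun v => bump alpha n (sqdist (0%R, 0%R) v) * Q v ^+ 2)).
  by apply: integrable_bump_profile => //; cont.
rewrite -subr_ge0 -RintegralB//.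
have := mean_value_bump (0, 0) n0 h2; rewrite Q0 expr0n/= subr0 => E.
rewrite (_ : (\int[@area R]_v _)%R = (u (0, 0) ^+ 2 * \int[@area R]_v bump alpha n (sqdist (0%R, 0%R) v))%R).
  by rewrite mulr_ge0 ?sqr_ge0// Rintegral_bump_ge0.
by rewrite -E; apply: eq_Rintegral => v _; rewrite mulrBr.
Qed.

(** Normalized to converge to the Gaussian from below: the factor is
    (1 - |z|^2 / n^2)^2 inside the disc of radius n = k + 1. *)
Definition cutoff (k : nat) z : R :=
  bump alpha k.+1%:R (sqdist (0, 0) z) / k.+1%:R ^+ 4.

Lemma sqdist0 z : sqdist (0, 0) z = z.1 ^+ 2 + z.2 ^+ 2.
Proof. by rewrite /sqdist !subr0. Qed.

Lemma cutoff_ge0 k z : 0 <= cutoff k z.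
Proof. by rewrite divr_ge0// bump_ge0. Qed.

Lemma cutoff_bounds k z :
  gauss alpha z * (1 - 2 * sqdist (0, 0) z * k.+1%:R^-1) <= cutoff k z <= gauss alpha z.
Proof.
have gE : gauss alpha z = expR (- alpha * sqdist (0, 0) z) by rewrite gaussE sqdist0.
rewrite /cutoff /bump -gE; set s := sqdist _ _; have s0 : 0 <= s := sqdist_ge0 _ _.
set n : R := k.+1%:R; have n1 : 1 <= n by rewrite ler1n.
have n0 : 0 < n by rewrite (lt_le_trans _ n1).
clearbody n s.
rewrite (_ : ramp _ ^+ 2 * _ / _ = gauss alpha z * (ramp (n ^+ 2 - s) ^+ 2 / n ^+ 4)); last first.
  by rewrite mulrAC mulrC.
have g0 := gauss_gt0 z; apply/andP; split; last first.
  rewrite ler_piMr ?(ltW g0)// ler_pdivrMr ?exprn_gt0// mul1r.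
  have -> : n ^+ 4 = (n ^+ 2) ^+ 2 by rewrite -exprM.
  rewrite lerXn2r ?nnegrE ?ramp_ge0 ?sqr_ge0//.
  by rewrite /ramp ge_max sqr_ge0/= lerBlDr lerDl.
rewrite ler_wpM2l ?(ltW g0)// ler_pdivlMr ?exprn_gt0//.
have -> : (1 - 2 * s * n^-1) * n ^+ 4 = n ^+ 4 - 2 * s * n ^+ 3.
  by field; rewrite gt_eqF.
have [ns|sn] := leP (n ^+ 2) s.
  rewrite ramp0 ?subr_le0// expr0n/=.
  have : n <= n ^+ 2 by rewrite expr2 ler_peMl// ltW.
  have : 0 <= n ^+ 3 by rewrite exprn_ge0// ltW.
  rewrite subr_le0 => n3 n2; rewrite exprS ler_wpM2r//; lra.
rewrite rampE; last by rewrite subr_ge0 ltW.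
have H : 0 <= s * n ^+ 2 * (n - 1).
  by rewrite mulr_ge0 ?subr_ge0// mulr_ge0// sqr_ge0.
rewrite -subr_ge0.
have -> : (n ^+ 2 - s) ^+ 2 - (n ^+ 4 - 2 * s * n ^+ 3) =
  2 * (s * n ^+ 2 * (n - 1)) + s ^+ 2 by ring.
by rewrite addr_ge0 ?sqr_ge0// mulr_ge0.
Qed.

Lemma cvg_cutoff z : cutoff k z @[k --> \oo] --> gauss alpha z.
Proof.
apply: (@squeeze_cvgr _ _ _ _
  (fun k => gauss alpha z * (1 - 2 * sqdist (0, 0) z * k.+1%:R^-1))
  (fun=> gauss alpha z)).
- by apply: nearW => k; exact: cutoff_bounds.
- have := cvgM (@cvg_cst _ (gauss alpha z) nat \oo _) (cvgB (@cvg_cst _ (1 : R) nat \oo _)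
    (cvgM (@cvg_cst _ (2 * sqdist (0, 0) z) nat \oo _) (@cvg_harmonic R))).
  rewrite mulr0 subr0 mulr1. by apply.
- exact: cvg_cst.
Qed.

(** Fatou's lemma removes the cutoff. *)
Lemma conjugate_energy u Q p q : holo u Q p q -> Q (0, 0) = 0 ->
  (\int[@area R]_v (Q v ^+ 2 * gauss alpha v)%:E <=
   \int[@area R]_v (u v ^+ 2 * gauss alpha v)%:E)%E.
Proof.
move=> h Q0; have [cu cQ] := holo_continuous h.
pose f k v := (cutoff k v * Q v ^+ 2)%:E.
have cc k (g : R * R -> R) : continuous g -> continuous (fun v => cutoff k v * g v ^+ 2).
  by move=> cg; have cb := @continuous_bump R alpha k.+1%:R; rewrite /cutoff /sqdist; cont.
have ms k (g : R * R -> R) : continuous g ->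
    measurable_fun [set: mplane] (fun v => (cutoff k v * g v ^+ 2)%:E).
  move=> cg; apply/measurable_EFinP.
  by apply: (@continuous_plane_measurable _ (fun v => cutoff k v * g v ^+ 2)); exact: cc.
have mu_ : measurable_fun [set: mplane] (fun v => (u v ^+ 2 * gauss alpha v)%:E).
  apply/measurable_EFinP; have cg := continuous_gauss.
  by apply: (@continuous_plane_measurable _ (fun v => u v ^+ 2 * gauss alpha v)); cont.
set I := (X in (_ <= X)%E).
have fI k : (\int[@area R]_v f k v <= I)%E.
  have cle (g : R * R -> R) : (fun v => cutoff k v * g v ^+ 2) =
      (fun v => k.+1%:R ^- 4 * (bump alpha k.+1%:R (sqdist (0%R, 0%R) v) * g v ^+ 2)).
    by apply/funext => v; rewrite /cutoff mulrAC mulrC.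
  have ig (g : R * R -> R) : continuous g ->
      (@area R).-integrable setT (EFin \o (fun v => bump alpha k.+1%:R (sqdist (0%R, 0%R) v) * g v ^+ 2)).
    by move=> cg; apply: integrable_bump_profile => //; cont.
  have ig2 (g : R * R -> R) : continuous g ->
      (@area R).-integrable setT (EFin \o (fun v => cutoff k v * g v ^+ 2)).
    move=> cg; rewrite cle.
    by have := integrableZl measurableT (k.+1%:R ^- 4) (ig g cg); apply: eq_integrable.
  have gE (g : R * R -> R) : continuous g ->
     (\int[@area R]_v (cutoff k v * g v ^+ 2)%:E =
       (\int[@area R]_v (cutoff k v * g v ^+ 2))%R%:E)%E.
    by move=> cg; rewrite /Rintegral fineK//; apply: integrable_fin_num => //; exact: ig2.
  apply: (@le_trans _ _ (\int[@area R]_v (cutoff k v * u v ^+ 2)%:E)%E).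
    rewrite /f !gE// lee_fin !cle !RintegralZl//; [|exact: ig..].
    by rewrite ler_wpM2l ?invr_ge0// ?exprn_ge0// (bump_energy _ h).
  apply: ge0_le_integral => //.
  - by move=> v _; rewrite lee_fin mulr_ge0 ?cutoff_ge0 ?sqr_ge0.
  - exact: ms.
  - by move=> v _; rewrite lee_fin mulrC ler_wpM2l ?sqr_ge0//; case/andP: (cutoff_bounds k v).
have f0 k v : [set: mplane] v -> (0 <= f k v)%E.
  by move=> _; rewrite lee_fin mulr_ge0 ?cutoff_ge0 ?sqr_ge0.
have fF := fatou (@area R) measurableT (fun k => ms k Q cQ) f0.
have -> : (\int[@area R]_v (Q v ^+ 2 * gauss alpha v)%:E =
    \int[@area R]_v limn_einf (f^~ v))%E.
  apply: eq_integral => v _.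
  have fv : f k v @[k --> \oo] --> (Q v ^+ 2 * gauss alpha v)%:E.
    apply: cvg_EFin; first exact: nearW.
    rewrite mulrC; apply: cvgM; [exact: cvg_cutoff|exact: cvg_cst].
  rewrite is_cvg_limn_einfE; first by apply/esym/cvg_lim.
  by apply/cvg_ex; eexists; exact: fv.
apply: le_trans fF _; rewrite limn_einf_lim; apply: lime_le.
  exact: is_cvg_einfs.
by apply: nearW => k; apply: le_trans (fI k); apply: ereal_inf_lbound; exists k => /=.
Qed.

End weighted_estimates.

(** * The local estimate *)

Section integral_comparison.
Context {R : realType} {d : measure_display} {T : measurableType d}.
Variable nu : {measure set T -> \bar R}.
Implicit Types (f g : T -> R).

Lemma integral_scale f (k : R) : measurable_fun setT f ->
  (forall x, 0 <= f x) -> 0 <= k ->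
  (\int[nu]_x (k * f x)%:E = k%:E * \int[nu]_x (f x)%:E)%E.
Proof.
move=> mf f0 k0; rewrite -ge0_integralZl_EFin//.
- by move=> x _; rewrite lee_fin.
- exact/measurable_EFinP.
Qed.

Lemma le_integral_scale f g (k : R) :
  measurable_fun setT f -> measurable_fun setT g ->
  (forall x, 0 <= f x) -> (forall x, 0 <= g x) -> 0 <= k ->
  (forall x, f x <= k * g x) ->
  (\int[nu]_x (f x)%:E <= k%:E * \int[nu]_x (g x)%:E)%E.
Proof.
move=> mf mg f0 g0 k0 fg; rewrite -integral_scale//; apply: ge0_le_integral => //.
- by move=> x _; rewrite lee_fin.
- exact/measurable_EFinP.
- by apply/measurable_EFinP; exact: measurable_funM.
- by move=> x _; rewrite lee_fin.
Qed.

End integral_comparison.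

Section nearby.
Context {R : realType}.
Notation mplane := (measurableTypeR R * measurableTypeR R)%type.
Implicit Types (c v z : R * R) (r : R).

(** Boxes rather than discs, because their area is immediate. *)
Definition nearby r c v : bool := (`|v.1 - c.1| < r) && (`|v.2 - c.2| < r).

Definition nearset r c : set mplane :=
  `]c.1 - r, c.1 + r[ `*` `]c.2 - r, c.2 + r[.

Lemma nearsetE r c v : nearset r c v <-> nearby r c v.
Proof.
by rewrite /nearset /nearby /= !in_itv/= !ltr_distl; split => [[-> ->]|/andP[]].
Qed.

Lemma nearbyC r c v : nearby r c v = nearby r v c.
Proof. by rewrite /nearby !(distrC _ (c.1)) !(distrC _ (c.2)). Qed.

Lemma measurable_nearset r c : measurable (nearset r c).
Proof. by apply: measurableX. Qed.

Lemma nearby_indicE r c : (fun v => (nearby r c v)%:R : R) = \1_(nearset r c).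
Proof.
apply/funext => v; rewrite indicE; congr (_%:R); congr (nat_of_bool _).
by apply/idP/idP => [/nearsetE/mem_set//|/set_mem/nearsetE].
Qed.

Lemma measurable_nearby r c :
  measurable_fun [set: mplane] (fun v => (nearby r c v)%:R : R).
Proof. by rewrite nearby_indicE; apply: measurable_indic; exact: measurable_nearset. Qed.

Lemma area_nearset r c : 0 < r -> @area R (nearset r c) = ((2 * r) ^+ 2)%:E.
Proof.
move=> r0; rewrite /area /nearset product_measure1E//= !lebesgue_measure_itv/= !lte_fin.
have E (t : R) : t - r < t + r by lra.
by rewrite !E -!EFinD -EFinM; congr EFin; ring.
Qed.

Lemma integral_nearby r c
   (nu : {measure set mplane -> \bar R}) :
  (\int[nu]_v ((nearby r c v)%:R)%:E = nu (nearset r c))%E.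
Proof.
transitivity (\int[nu]_v (\1_(nearset r c) v : R)%:E)%E.
  by apply: eq_integral => v _; rewrite -nearby_indicE.
by rewrite integral_indic ?setIT//; exact: measurable_nearset.
Qed.

Lemma integral_nearby_area r c : 0 < r ->
  (\int[@area R]_v ((nearby r c v)%:R)%:E = ((2 * r) ^+ 2)%:E)%E.
Proof.
by move=> r0; transitivity (@area R (nearset r c)); [exact: integral_nearby|exact: area_nearset].
Qed.

Lemma sqdist_nearby r c v : 0 < r -> sqdist c v < r ^+ 2 -> nearby r c v.
Proof.
move=> r0 H.
have S (a b : R) : a ^+ 2 + b ^+ 2 < r ^+ 2 -> `|a| < r.
  move=> ab; rewrite -(@ltr_pXn2r _ 2)// ?nnegrE ?ltW// real_normK ?num_real//.
  by have := sqr_ge0 b; lra.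
by rewrite /nearby (S _ _ H)/=; apply: (S _ (v.1 - c.1)); rewrite addrC.
Qed.

Lemma nearby_sqdist r c v : 0 < r -> nearby r c v -> sqdist c v <= 2 * r ^+ 2.
Proof.
move=> r0 /andP[/ltW h1 /ltW h2].
have S (a : R) : `|a| <= r -> a ^+ 2 <= r ^+ 2.
  by move=> ar; rewrite -(real_normK (num_real a)) lerXn2r ?nnegrE// ltW.
by have := S _ h1; have := S _ h2; rewrite /sqdist; lra.
Qed.

End nearby.

Section local_estimate.
Context {R : realType}.
Variable alpha : R.
Hypothesis alpha0 : 0 < alpha.
Notation mplane := (measurableTypeR R * measurableTypeR R)%type.
Implicit Types (u P Q p q : R * R -> R) (c v z : R * R).

(** On the box of half-side r / 2 around c the bump is bounded below by a
    constant, and the area of that box is r^2. *)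
Lemma bump_mass_lower (r : R) : 0 < r -> exists2 kappa : R, 0 < kappa &
  forall c, kappa <= (\int[@area R]_v bump alpha r (sqdist c v))%R.
Proof.
move=> r0; pose k0 := (r ^+ 2 / 2) ^+ 2 * expR (- alpha * (r ^+ 2 / 2)).
have r20 : 0 < r ^+ 2 / 2 by rewrite divr_gt0// exprn_gt0.
have k00 : 0 < k0 by rewrite mulr_gt0 ?expR_gt0// exprn_gt0.
exists (k0 * (2 * (r / 2)) ^+ 2) => [|c].
  by rewrite mulr_gt0// exprn_gt0// mulr_gt0// divr_gt0.
have cb : continuous (fun v => bump alpha r (sqdist c v)).
  by have := @continuous_bump R alpha r; rewrite /sqdist => ?; cont.
have ib : (@area R).-integrable setT (EFin \o (fun v => bump alpha r (sqdist c v))).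
  have := @integrable_bump_profile R alpha c r (fun=> 1) r0 (@continuous_cstE _ _ _).
  by under eq_fun do rewrite mulr1.
rewrite -lee_fin /Rintegral fineK; last exact: integrable_fin_num.
rewrite EFinM -(integral_nearby_area c) ?divr_gt0//.
rewrite -integral_scale//; last 2 first.
- exact: measurable_nearby.
- exact: ltW.
rewrite -[X in (_ <= X)%E]mul1e; apply: le_integral_scale => //.
- by apply: measurable_funM => //; exact: measurable_nearby.
- exact: (continuous_plane_measurable cb).
- by move=> v; rewrite mulr_ge0// ltW.
- by move=> v; exact: bump_ge0.
move=> v; rewrite mul1r; case: (boolP (nearby _ c v)) => [H|_].
  have := nearby_sqdist (divr_gt0 r0 (ltr0Sn _ 1)) H.
  have -> : 2 * (r / 2) ^+ 2 = r ^+ 2 / 2 by field.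
  move=> s; rewrite mulr1 /k0 /bump ler_pM ?sqr_ge0 ?expR_ge0//.
    have le : r ^+ 2 / 2 <= ramp (r ^+ 2 - sqdist c v) by rewrite rampE; lra.
    by rewrite lerXn2r ?nnegrE ?ramp_ge0 ?(ltW r20).
  by rewrite ler_expR !mulNr lerN2 ler_wpM2l// ltW.
by rewrite mulr0 bump_ge0.
Qed.

(** The mean value property at c for conj(F(c))^2 F(v)^2 e^(-2 alpha conj(c) (v - c)),
    F = P + i Q.  The exponential turns the radial Gaussian about c into the
    Gaussian about 0, and the constant conj(F(c))^2 makes the value at c real, so
    that the real part alone controls |F(c)|^4. *)
Lemma local_submean (r : R) : 0 < r -> exists2 K : R, 0 < K &
  forall P Q p q, holo P Q p q -> forall c,
  (((P c ^+ 2 + Q c ^+ 2) * gauss alpha c)%:E <= K%:E *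
    \int[@area R]_v ((nearby r c v)%:R *
       ((P v ^+ 2 + Q v ^+ 2) * gauss alpha v))%:E)%E.
Proof.
move=> r0; have [kappa k0 kB] := bump_mass_lower r0.
exists (r ^+ 4 / kappa) => [|P Q p q h c]; first by rewrite divr_gt0// exprn_gt0.
have [cP cQ] := holo_continuous h.
pose m v := P v ^+ 2 + Q v ^+ 2.
have m_ge0 v : 0 <= m v by rewrite addr_ge0// sqr_ge0.
pose s0 := P c ^+ 2 - Q c ^+ 2; pose t0 := 2 * (P c * Q c).
(* A + i B = -2 alpha conj(c) (v - c), and s0 + i t0 = F(c)^2 *)
pose A v := - (2 * alpha * c.1) * (v.1 - c.1) - 2 * alpha * c.2 * (v.2 - c.2).
pose B v := - (2 * alpha * c.1) * (v.2 - c.2) + 2 * alpha * c.2 * (v.1 - c.1).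
have cA : continuous A by rewrite /A; cont.
have cm : continuous m by rewrite /m; cont.
have [p2 [q2 h2]] := holo_sqr h.
have h3 := holo_mul (holo_mul h2 (holo_cst s0 (- t0)))
  (holo_exp (- (2 * alpha * c.1)) (2 * alpha * c.2) c).
set p3 := (X in holo _ _ X _) in h3; set q3 := (X in holo _ _ _ X) in h3.
set G := (X in holo X _ _ _) in h3.
pose b v := bump alpha r (sqdist c v).
have Gc : G c = m c ^+ 2.
  by rewrite /G !subrr !mulr0 addr0 subr0 expR0 cos0 sin0 /s0 /t0 /m; ring.
have Gle v : G v <= m c * (m v * expR (A v)).
  rewrite /G -/(A v) -/(B v).
  set X := (X in X * (_ * cos _) - _); set Y := (X in _ - X * _).
  have -> : X * (expR (A v) * cos (B v)) - Y * (expR (A v) * sin (B v)) =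
    (X * cos (B v) - Y * sin (B v)) * expR (A v) by ring.
  rewrite mulrA ler_wpM2r ?expR_ge0//.
  have XY : X ^+ 2 + Y ^+ 2 = (m c * m v) ^+ 2.
    by rewrite /X /Y /s0 /t0 /m; ring.
  have cs := cos2Dsin2 (B v).
  have le : (X * cos (B v) - Y * sin (B v)) ^+ 2 <= (m c * m v) ^+ 2.
    rewrite -XY -[leRHS]mulr1 -cs -subr_ge0.
    have -> : (X ^+ 2 + Y ^+ 2) * (cos (B v) ^+ 2 + sin (B v) ^+ 2) -
       (X * cos (B v) - Y * sin (B v)) ^+ 2 = (X * sin (B v) + Y * cos (B v)) ^+ 2 by ring.
    exact: sqr_ge0.
  have mm : 0 <= m c * m v by rewrite mulr_ge0.
  rewrite (le_trans (ler_norm _))// -(@ler_pXn2r _ 2)// ?nnegrE//.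
  by rewrite real_normK ?num_real.
have cE : continuous (fun v => m v * expR (A v)) by cont.
have cG : continuous G by case: (holo_continuous h3).
pose J := (\int[@area R]_v (b v * (m v * expR (A v))))%R.
have iJ := integrable_bump_profile alpha c r0 cE.
have iG := integrable_bump_profile alpha c r0 cG.
have J0 : 0 <= J.
  by apply: Rintegral_ge0 => v _; rewrite mulr_ge0 ?bump_ge0// mulr_ge0 ?expR_ge0.
have mJ : m c * (\int[@area R]_v b v)%R <= J.
  have [/eqP mc0|mc0] := boolP (m c == 0); first by rewrite mc0 mul0r.
  have {}mc0 : 0 < m c by rewrite lt_neqAle eq_sym mc0 m_ge0.
  rewrite -(ler_pM2l mc0) mulrA -expr2 -Gc -(mean_value_bump alpha c r0 h3).
  rewrite -RintegralZl//; apply: le_Rintegral => //.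
    by have := integrableZl measurableT (m c) iJ; apply: eq_integrable.
  by move=> v _; rewrite mulrCA ler_wpM2l ?bump_ge0.
have Jle : (J%:E <= (r ^+ 4 * expR (alpha * (c.1 ^+ 2 + c.2 ^+ 2)))%:E *
    \int[@area R]_v ((nearby r c v)%:R * (m v * gauss alpha v))%:E)%E.
  rewrite /J /Rintegral fineK; last exact: integrable_fin_num.
  have cg := @continuous_gauss R alpha.
  have mn : measurable_fun [set: mplane] (fun v => (nearby r c v)%:R * (m v * gauss alpha v)).
    apply: measurable_funM; first exact: measurable_nearby.
    by apply: (@continuous_plane_measurable _ (fun v => m v * gauss alpha v)); cont.
  have n0 v : 0 <= (nearby r c v)%:R * (m v * gauss alpha v).
    by rewrite mulr_ge0// mulr_ge0// expR_ge0.
  apply: le_integral_scale => //.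
  - by apply/measurable_EFinP; case/integrableP : iJ.
  - by move=> v; rewrite mulr_ge0 ?bump_ge0// mulr_ge0 ?expR_ge0.
  - by rewrite mulr_ge0 ?expR_ge0// exprn_ge0// ltW.
  move=> v.
  have [rv|vr] := leP (r ^+ 2) (sqdist c v).
    by rewrite /b bump0// mul0r mulr_ge0// mulr_ge0 ?expR_ge0// exprn_ge0// ltW.
  rewrite (sqdist_nearby r0 vr) mul1r /b /bump gaussE.
  have -> : ramp (r ^+ 2 - sqdist c v) ^+ 2 * expR (- alpha * sqdist c v) * (m v * expR (A v)) =
    m v * (ramp (r ^+ 2 - sqdist c v) ^+ 2 * (expR (- alpha * sqdist c v) * expR (A v))) by ring.
  have -> : r ^+ 4 * expR (alpha * (c.1 ^+ 2 + c.2 ^+ 2)) * (m v * expR (- alpha * (v.1 ^+ 2 + v.2 ^+ 2))) =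
    m v * (r ^+ 4 * (expR (alpha * (c.1 ^+ 2 + c.2 ^+ 2)) * expR (- alpha * (v.1 ^+ 2 + v.2 ^+ 2)))) by ring.
  rewrite ler_wpM2l// -!expRD.
  have -> : - alpha * sqdist c v + A v = alpha * (c.1 ^+ 2 + c.2 ^+ 2) + - alpha * (v.1 ^+ 2 + v.2 ^+ 2).
    by rewrite /sqdist /A; ring.
  rewrite ler_wpM2r ?expR_ge0//.
  have -> : r ^+ 4 = (r ^+ 2) ^+ 2 by rewrite -exprM.
  have le : ramp (r ^+ 2 - sqdist c v) <= r ^+ 2.
    by rewrite rampE ?gerBl ?sqdist_ge0// subr_ge0 ltW.
  by rewrite lerXn2r ?nnegrE ?ramp_ge0 ?sqr_ge0.
rewrite mulrC -[X in (_ <= X)%E]mul1e.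
set I := (\int[_]_v _)%E in Jle *.
have gc : gauss alpha c * expR (alpha * (c.1 ^+ 2 + c.2 ^+ 2)) = 1.
  by rewrite gaussE mulNr -expRD addNr expR0.
have g0 := gauss_gt0 alpha c.
apply: (@le_trans _ _ ((gauss alpha c / kappa)%:E * J%:E)%E).
  rewrite -EFinM lee_fin -mulrA ler_wpM2l ?(ltW g0)// mulrC ler_pdivlMr//.
  apply: le_trans mJ; apply: ler_wpM2l (kB c); exact: m_ge0.
apply: (@le_trans _ _ ((gauss alpha c / kappa)%:E * ((r ^+ 4 * expR (alpha * (c.1 ^+ 2 + c.2 ^+ 2)))%:E * I))%E).
  by rewrite lee_wpmul2l// lee_fin divr_ge0// ltW.
rewrite mul1e muleA -EFinM.
have -> // : gauss alpha c / kappa * (r ^+ 4 * expR (alpha * (c.1 ^+ 2 + c.2 ^+ 2))) = r ^+ 4 / kappa.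
by rewrite -[RHS]mul1r -gc; ring.
Qed.

End local_estimate.

(** * The reproducing kernels and the Berezin transform *)

Section kernel_formulas.
Local Open Scope complex_scope.
Local Open Scope ring_scope.
Context {R : realType}.
Variable alpha : R.
Hypothesis alpha0 : 0 < alpha.
Implicit Types (c v z w : R * R).

(** The real and the imaginary part of conj(z) w. *)
Definition rdot z w : R := z.1 * w.1 + z.2 * w.2.
Definition rdet z w : R := z.1 * w.2 - z.2 * w.1.

(** The real and the imaginary part of K_z(w). *)
Definition kcos z w : R := expR (alpha * rdot z w) * cos (alpha * rdet z w).
Definition ksin z w : R := expR (alpha * rdot z w) * sin (alpha * rdet z w).

Lemma conjCE (a b : R) : Num.conj (a +i* b) = a -i* b :> R[i].
Proof. by []. Qed.

Lemma mulCE (a b c d : R) : (a +i* b) * (c +i* d) = (a * c - b * d) +i* (a * d + b * c) :> R[i].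
Proof. by []. Qed.

Lemma addCE (a b c d : R) : (a +i* b) + (c +i* d) = (a + c) +i* (b + d) :> R[i].
Proof. by []. Qed.

Lemma realCE (a : R) : a%:C = a +i* 0 :> R[i].
Proof. by []. Qed.

Lemma fock_KE z w : fock_K alpha z w = kcos z w +i* ksin z w.
Proof.
case: z w => [x y] [a b]; rewrite /fock_K /cpx/= conjCE realCE !mulCE /cexp/= realCE mulCE.
rewrite !(mul0r, subr0, addr0) /kcos /ksin /rdot /rdet /=.
by congr (expR _ * cos _ +i* (expR _ * sin _)); ring.
Qed.

Lemma fock_HE z w : fock_H alpha z w = (2 * kcos z w)%:C.
Proof.
rewrite /fock_H fock_KE conjCE addCE realCE subrr.
by congr (_ +i* _); rewrite mulr_natl mulr2n.
Qed.

Lemma cmodM (x y : R[i]) : cmod (x * y) = cmod x * cmod y.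
Proof. exact: ComplexField.Normc.normcM. Qed.

Lemma cmodV (x : R[i]) : cmod x^-1 = (cmod x)^-1.
Proof. exact: ComplexField.Normc.normcV. Qed.

Lemma cmod_real (a : R) : cmod a%:C ^+ 2 = a ^+ 2.
Proof. by rewrite cmod_sqr/= expr0n/= addr0. Qed.

Lemma cmod_sqrtC (x : R[i]) : cmod (sqrtC x) ^+ 2 = cmod x.
Proof. by rewrite expr2 -cmodM -expr2 sqrtCK. Qed.

Lemma fock_HzzE z : fock_H alpha z z = (2 * expR (alpha * (z.1 ^+ 2 + z.2 ^+ 2)))%:C.
Proof.
have -> : fock_H alpha z z = (2 * kcos z z)%:C by exact: fock_HE.
have rz : rdet z z = 0 by rewrite /rdet [z.1 * _]mulrC subrr.
by rewrite /kcos rz mulr0 cos0 mulr1 /rdot -!expr2.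
Qed.

Lemma cmod_fock_Hzz z : cmod (fock_H alpha z z) = 2 * expR (alpha * (z.1 ^+ 2 + z.2 ^+ 2)).
Proof.
have E0 : 0 <= 2 * expR (alpha * (z.1 ^+ 2 + z.2 ^+ 2)) by rewrite mulr_ge0 ?expR_ge0.
apply/eqP; rewrite -(@eqrXn2 _ 2)//; last by rewrite /cmod; case: (fock_H _ _ _) => ? ?; exact: sqrtr_ge0.
by rewrite fock_HzzE cmod_real.
Qed.

(** Completing the square: the kernel at z is, up to a constant, a Gaussian
    centred at z. *)
Lemma kcos_gauss z w : kcos z w ^+ 2 * gauss alpha w =
  expR (alpha * (z.1 ^+ 2 + z.2 ^+ 2)) *
  (cos (alpha * rdet z w) ^+ 2 * expR (- alpha * sqdist z w)).
Proof.
rewrite gaussE /kcos exprMn -expRM_natl mulrAC -expRD.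
rewrite [in RHS]mulrCA -expRD mulrC; congr (_ * expR _).
by rewrite /rdot /sqdist; ring.
Qed.

Definition berezin_density z w : R :=
  2 * (cos (alpha * rdet z w) ^+ 2 * expR (- alpha * sqdist z w)).

Lemma fock_h_gauss z w :
  cmod (fock_h alpha z w) ^+ 2 * gauss alpha w = berezin_density z w.
Proof.
rewrite /fock_h cmodM exprMn cmodV exprVn cmod_sqrtC fock_HE cmod_real exprMn.
rewrite cmod_fock_Hzz.
have rearrange : forall a b c d : R, a * b / c * d = a / c * (b * d) by move=> *; ring.
rewrite rearrange kcos_gauss /berezin_density.
by field; rewrite gt_eqF// expR_gt0.
Qed.

Lemma berezin_density_ge0 z w : 0 <= berezin_density z w.
Proof. by rewrite mulr_ge0// mulr_ge0 ?sqr_ge0 ?expR_ge0. Qed.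

Lemma continuous_berezin_density z : continuous (berezin_density z).
Proof. by rewrite /berezin_density /rdet /sqdist; cont. Qed.

Lemma sin_abs_le (x : R) : `|sin x| <= `|x|.
Proof.
have := @derive_increment R sin cos 0 x 0 1 (fun s => is_derive_sin s).
by rewrite sin0 !subr0 mul0r subr0 mul1r; apply => s _; rewrite subr0 cos_max.
Qed.

(** For u near p the phase alpha Im(conj(p) u) is small when |p| is small, and
    one density suffices.  When |p| is large, moving p by i t p with
    t = pi / (2 alpha |p|^2), a displacement of bounded length, changes the phase
    by nearly pi / 2, and the squares of cos x and cos (x - b) do not vanish
    together for b near pi / 2. *)
Lemma two_densities : exists r K : R, [/\ 0 < r, 0 < K & forall p, exists p',
  forall u, nearby r p u ->
    1 <= K * (berezin_density p u + berezin_density p' u)].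
Proof.
(* small enough for alpha r^2 = 1 / 8, which bounds the phase errors *)
pose r := Num.sqrt (8 * alpha)^-1.
have r2 : r ^+ 2 = (8 * alpha)^-1 by rewrite sqr_sqrtr// invr_ge0 mulr_ge0// ltW.
have ar2 : alpha * r ^+ 2 = 8^-1 by rewrite r2; field; rewrite gt_eqF.
have r0 : 0 < r by rewrite sqrtr_gt0 invr_gt0 mulr_gt0.
have E (x : R) : x <= 9 / 2 -> expR (- (9 / 2)) <= expR (- x).
  by move=> x9; rewrite ler_expR lerN2.
have K0 : 0 < 2 * expR (9 / 2) :> R by rewrite mulr_gt0 ?expR_gt0.
exists r, (2 * expR (9 / 2)); split => //.
move=> p; pose s := p.1 ^+ 2 + p.2 ^+ 2.
have s0 : 0 <= s by rewrite addr_ge0// sqr_ge0.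
have K1 (X Y : R) : 4^-1 * expR (- (9 / 2)) * 2 <= X + Y -> 1 <= 2 * expR (9 / 2) * (X + Y).
  move=> H; apply: (@le_trans _ _ (2 * expR (9 / 2) * (4^-1 * expR (- (9 / 2)) * 2))).
    rewrite expRN; rewrite le_eqVlt; apply/orP; left; apply/eqP; field.
    by rewrite gt_eqF// expR_gt0.
  by rewrite ler_wpM2l// mulr_ge0 ?expR_ge0.
have near2 u : nearby r p u -> (u.1 - p.1) ^+ 2 + (u.2 - p.2) ^+ 2 <= 2 * r ^+ 2.
  exact: nearby_sqdist.
have [small|large] := leP s (16 * r ^+ 2).
  exists p => u nu; apply: K1.
  have pu := near2 u nu.
  have ndet : (rdet p u) ^+ 2 <= 32 * (r ^+ 2) ^+ 2.
    have -> : rdet p u = p.1 * (u.2 - p.2) - p.2 * (u.1 - p.1) by rewrite /rdet; ring.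
    apply: (@le_trans _ _ (s * ((u.1 - p.1) ^+ 2 + (u.2 - p.2) ^+ 2))).
      rewrite -subr_ge0; rewrite [X in 0 <= X](_ : _ = (p.1 * (u.1 - p.1) + p.2 * (u.2 - p.2)) ^+ 2) ?sqr_ge0//.
      by rewrite /s; ring.
    have -> : 32 * (r ^+ 2) ^+ 2 = 16 * r ^+ 2 * (2 * r ^+ 2) by ring.
    by apply: ler_pM => //; rewrite addr_ge0 ?sqr_ge0.
  have c2 : 2^-1 <= cos (alpha * rdet p u) ^+ 2.
    rewrite cos2sin2.
    have : sin (alpha * rdet p u) ^+ 2 <= (alpha * rdet p u) ^+ 2.
      rewrite -(real_normK (num_real (sin _))) -(real_normK (num_real (alpha * _))).
      by rewrite lerXn2r ?nnegrE// sin_abs_le.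
    have : (alpha * rdet p u) ^+ 2 <= 32 * (alpha * r ^+ 2) ^+ 2.
      have -> : 32 * (alpha * r ^+ 2) ^+ 2 = alpha ^+ 2 * (32 * (r ^+ 2) ^+ 2) by ring.
      by rewrite exprMn ler_wpM2l ?sqr_ge0.
    by rewrite ar2; lra.
  have e2 : expR (- (9 / 2)) <= expR (- alpha * sqdist p u).
    rewrite mulNr; apply: E; apply: (@le_trans _ _ (alpha * (2 * r ^+ 2))).
      by rewrite ler_wpM2l// ltW.
    by rewrite mulrCA ar2; lra.
  have e0 := expR_gt0 (- (9 / 2) : R).
  rewrite /berezin_density; nra.
pose t := pi / (2 * alpha * s).
have s_gt0 : 0 < s by rewrite (lt_trans _ large)// mulr_gt0// exprn_gt0.
pose p' : R * R := (p.1 - t * p.2, p.2 + t * p.1).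
exists p' => u nu; apply: K1.
have pu := near2 u nu.
have pi4 : pi ^+ 2 <= 16 :> R.
  have -> : 16 = 4 ^+ 2 :> R by rewrite -natrX.
  by rewrite lerXn2r ?nnegrE ?pi_ge0//; have := pihalf_lt2 R; lra.
pose b := alpha * (t * (s + (p.1 * (u.1 - p.1) + p.2 * (u.2 - p.2)))).
have bE : alpha * rdet p' u = alpha * rdet p u - b.
  by rewrite /b /rdet /p' /s /=; ring.
have at_s : alpha * t * s = pi / 2.
  by rewrite /t; field; rewrite !gt_eqF.
have cosb : (cos b) ^+ 2 <= 2^-1.
  have -> : b = pi / 2 + alpha * t * (p.1 * (u.1 - p.1) + p.2 * (u.2 - p.2)).
    by rewrite /b -at_s; ring.
  set d := p.1 * _ + _.
  have -> : cos (pi / 2 + alpha * t * d) = - sin (alpha * t * d).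
    by rewrite addrC cosDpihalf.
  rewrite sqrrN.
  have : sin (alpha * t * d) ^+ 2 <= (alpha * t * d) ^+ 2.
    rewrite -(real_normK (num_real (sin _))) -(real_normK (num_real (alpha * _ * _))).
    by rewrite lerXn2r ?nnegrE// sin_abs_le.
  move=> H; apply: (le_trans H).
  have ds : d ^+ 2 <= s * (2 * r ^+ 2).
    apply: (@le_trans _ _ (s * ((u.1 - p.1) ^+ 2 + (u.2 - p.2) ^+ 2))).
      rewrite -subr_ge0; rewrite [X in 0 <= X](_ : _ = (p.1 * (u.2 - p.2) - p.2 * (u.1 - p.1)) ^+ 2) ?sqr_ge0//.
      by rewrite /s /d; ring.
    by rewrite ler_wpM2l.
  have ats2 : (alpha * t * s) ^+ 2 <= 4 by rewrite at_s; nra.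
  have : (alpha * t * d) ^+ 2 * s <= 2^-1 * s.
    rewrite exprMn; apply: (@le_trans _ _ ((alpha * t) ^+ 2 * (s * (2 * r ^+ 2)) * s)).
      by rewrite ler_wpM2r// ler_wpM2l// sqr_ge0.
    have -> : (alpha * t) ^+ 2 * (s * (2 * r ^+ 2)) * s = (alpha * t * s) ^+ 2 * (2 * r ^+ 2) by ring.
    have : (alpha * t * s) ^+ 2 * (2 * r ^+ 2) <= 4 * (2 * r ^+ 2).
      by rewrite ler_wpM2r// mulr_ge0// sqr_ge0.
    by move: large; lra.
  by rewrite ler_pM2r.
(* the sum is 1 + cos b * cos (2 x - b), and |cos b| is at most 3 / 4 *)
have csum : 4^-1 <= cos (alpha * rdet p u) ^+ 2 + cos (alpha * rdet p' u) ^+ 2.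
  rewrite bE; set a := alpha * rdet p u; rewrite cosB.
  have := cos2Dsin2 a; have := cos2Dsin2 b; move: cosb.
  move: (cos a) (sin a) (cos b) (sin b) => ca sa cb sb h1 h2 h3.
  have -> : ca ^+ 2 + (ca * cb + sa * sb) ^+ 2 = 1 + cb * (cb * (ca ^+ 2 - sa ^+ 2) + 2 * ca * sa * sb).
    rewrite sqrrD !exprMn.
    have -> : sb ^+ 2 = 1 - cb ^+ 2 by lra.
    have -> : sa ^+ 2 = 1 - ca ^+ 2 by lra.
    ring.
  set y := cb * (ca ^+ 2 - sa ^+ 2) + 2 * ca * sa * sb.
  have y1 : y ^+ 2 <= 1.
    have <- : (cb ^+ 2 + sb ^+ 2) * (ca ^+ 2 + sa ^+ 2) ^+ 2 = 1 by rewrite h2 h3; ring.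
    rewrite -subr_ge0 [X in 0 <= X](_ : _ = (sb * (ca ^+ 2 - sa ^+ 2) - 2 * ca * sa * cb) ^+ 2) ?sqr_ge0//.
    by rewrite /y; ring.
  by nra.
have dp : sqdist p u <= 2 * r ^+ 2 by exact: pu.
have dp' : sqdist p' u <= 4 * r ^+ 2 + 4 / alpha.
  have : sqdist p' u <= 2 * sqdist p u + 2 * (t ^+ 2 * s).
    rewrite -subr_ge0 [X in 0 <= X](_ : _ = (u.1 - p.1 - t * p.2) ^+ 2 + (u.2 - p.2 + t * p.1) ^+ 2).
      by rewrite addr_ge0// sqr_ge0.
    by rewrite /sqdist /p' /s /=; ring.
  have : 2 * (t ^+ 2 * s) <= 4 / alpha.
    have -> : 2 * (t ^+ 2 * s) = pi ^+ 2 / (2 * alpha ^+ 2 * s).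
      by rewrite /t; field; rewrite !gt_eqF.
    rewrite ler_pdivrMr ?mulr_gt0// ?exprn_gt0//.
    have -> : 4 / alpha * (2 * alpha ^+ 2 * s) = 8 * (alpha * s) by field; rewrite gt_eqF.
    apply: le_trans pi4 _.
    have : alpha * (16 * r ^+ 2) <= alpha * s by rewrite ler_pM2l// ltW.
    by rewrite mulrCA ar2; lra.
  by lra.
have e1 : expR (- (9 / 2)) <= expR (- alpha * sqdist p u).
  rewrite mulNr; apply: E; apply: (@le_trans _ _ (alpha * (2 * r ^+ 2))).
    by rewrite ler_wpM2l// ltW.
  by rewrite mulrCA ar2; lra.
have e2 : expR (- (9 / 2)) <= expR (- alpha * sqdist p' u).
  rewrite mulNr; apply: E; apply: (@le_trans _ _ (alpha * (4 * r ^+ 2 + 4 / alpha))).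
    by rewrite ler_wpM2l// ltW.
  rewrite mulrDr mulrCA ar2 mulrCA divff ?gt_eqF//; lra.
have e0 := expR_gt0 (- (9 / 2) : R).
apply: (@le_trans _ _ (2 * ((cos (alpha * rdet p u) ^+ 2 + cos (alpha * rdet p' u) ^+ 2) * expR (- (9 / 2))))).
  by rewrite [leLHS]mulrC ler_wpM2l// ler_wpM2r// ltW.
rewrite /berezin_density -mulrDr ler_wpM2l// mulrDl lerD// ler_wpM2l// sqr_ge0//.
Qed.

End kernel_formulas.

(** * Measures of bounded boxes *)

Section gaussian_area.
Context {R : realType}.
Notation mplane := (measurableTypeR R * measurableTypeR R)%type.
Notation leb := (@lebesgue_measure R).
Variable beta : R.
Hypothesis beta0 : 0 < beta.
Implicit Types (c v z w : R * R).

Lemma integral_gaussian_line : exists2 G : R, 0 <= G & forall m : R,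
  (\int[leb]_x (expR (- beta * (x - m) ^+ 2))%:E = G%:E)%E.
Proof.
pose s := Num.sqrt (2 * beta)^-1.
have s0 : s != 0 by rewrite gt_eqF// sqrtr_gt0 invr_gt0 mulr_gt0.
have s2 : (s ^+ 2 *+ 2)^-1 = beta.
  rewrite sqr_sqrtr ?invr_ge0 ?mulr_ge0 ?ltW// -mulr_natr.
  by field; rewrite gt_eqF.
have p0 := normal_peak_gt0 s0.
exists (normal_peak s)^-1 => [|m]; first by rewrite invr_ge0 ltW.
have E x : expR (- beta * (x - m) ^+ 2) = (normal_peak s)^-1 * normal_pdf m s x.
  by rewrite normal_pdfE// mulKf ?gt_eqF// /normal_fun s2 mulrC mulrN mulNr.
under eq_integral do rewrite E.
rewrite integral_scale.
- by rewrite integral_normal_pdf mule1.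
- exact: measurable_normal_pdf.
- exact: normal_pdf_ge0.
- by rewrite invr_ge0 ltW.
Qed.

Lemma continuous_gaussian c : continuous (fun v => expR (- beta * sqdist c v)).
Proof. by rewrite /sqdist; cont. Qed.

Lemma measurable_gaussian c :
  measurable_fun [set: mplane] (fun v => expR (- beta * sqdist c v)).
Proof. exact: (continuous_plane_measurable (@continuous_gaussian c)). Qed.

Lemma integral_gaussian_plane : exists2 G : R, 0 <= G & forall c,
  (\int[@area R]_v (expR (- beta * sqdist c v))%:E = G%:E)%E.
Proof.
have [G G0 GE] := integral_gaussian_line.
exists (G * G) => [|c]; first by rewrite mulr_ge0.
transitivity (\int[leb]_x \int[leb]_y (expR (- beta * sqdist c (x, y)))%:E)%E.
  apply: (@fubini_tonelli1 _ _ _ _ R leb leb (fun v => (expR (- beta * sqdist c v))%:E)).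
    by apply/measurable_EFinP; exact: measurable_gaussian.
  by move=> v; rewrite lee_fin expR_ge0.
have E x : (\int[leb]_y (expR (- beta * sqdist c (x, y)))%:E =
    (G * expR (- beta * (x - c.1) ^+ 2))%:E)%E.
  have -> : (fun y => (expR (- beta * sqdist c (x, y)))%:E) =
     (fun y => (expR (- beta * (x - c.1) ^+ 2) * expR (- beta * (y - c.2) ^+ 2))%:E).
    by apply/funext => y; rewrite -expRD /sqdist /= mulrDr.
  rewrite integral_scale.
  - by rewrite GE -EFinM mulrC.
  - by apply: continuous_measurable_fun; cont.
  - by move=> y; exact: expR_ge0.
  - exact: expR_ge0.
under eq_integral do rewrite E.
rewrite integral_scale.
- by rewrite GE -EFinM.
- by apply: continuous_measurable_fun; cont.
- by move=> x; exact: expR_ge0.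
- exact: G0.
Qed.

End gaussian_area.

(** A transparent copy, so that integrals against it are integrals against mu
    while sigma-finiteness is found by inference. *)
Definition sigma_finite_copy {R : realType} {d : measure_display}
  {T : measurableType d} {mu : {measure set T -> \bar R}}
  (_ : sigma_finite setT mu) : set T -> \bar R := mu.

HB.instance Definition _ (R : realType) (d : measure_display)
    (T : measurableType d) (mu : {measure set T -> \bar R})
    (H : sigma_finite setT mu) := Measure.copy (sigma_finite_copy H) mu.

HB.instance Definition _ (R : realType) (d : measure_display)
    (T : measurableType d) (mu : {measure set T -> \bar R})
    (H : sigma_finite setT mu) :=
  Measure_isSigmaFinite.Build _ _ _ (sigma_finite_copy H) H.

Section box_bounded_sigma_finite.
Context {R : realType}.
Notation mplane := (measurableTypeR R * measurableTypeR R)%type.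
Variable mu : {measure set mplane -> \bar R}.
Variables (r C : R).
Hypothesis r0 : 0 < r.
Hypothesis muC : forall p, (mu (nearset r p) <= C%:E)%E.
Implicit Types (p v z w : R * R).

(** Countably many boxes, with rational centres, cover the plane. *)
Lemma box_bounded_sigma_finite : sigma_finite setT mu.
Proof.
pose F (n : nat) : set mplane := if @unpickle (rat * rat)%type n is Some q
  then nearset r (ratr q.1, ratr q.2) else set0.
exists F => [|n]; last first.
  rewrite /F; case: unpickle => [q|]; last by rewrite measure0; split.
  by split; [exact: measurable_nearset|exact: le_lt_trans (muC _) (ltry _)].
apply/esym/seteqP; split => // -[x y] _.
have rx (t : R) : exists q : rat, `|t - ratr q| < r.
  have tq : t < t + r by rewrite ltrDl.
  have [q] := rat_in_itvoo tq; rewrite in_itv/= => /andP[tp pq].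
  by exists q; rewrite distrC ger0_norm ?subr_ge0 ?(ltW tp)// ltrBlDl.
have [q1 h1] := rx x; have [q2 h2] := rx y.
exists (pickle (q1, q2)); first exact: I.
rewrite /F pickleK.
by apply/nearsetE; rewrite /nearby /= h1.
Qed.

End box_bounded_sigma_finite.

Section box_bounded.
Context {R : realType}.
Notation mplane := (measurableTypeR R * measurableTypeR R)%type.
Implicit Types (p v z w : R * R).

Lemma area_sigma_finite : sigma_finite setT (@area R).
Proof.
apply: (@box_bounded_sigma_finite R (@area R) 1 ((2 * 1) ^+ 2) ltr01) => p.
by rewrite -(@area_nearset R 1 p ltr01).
Qed.

Let ar : {sigma_finite_measure set mplane -> \bar R} :=
  sigma_finite_copy area_sigma_finite.

Variable mu : {measure set mplane -> \bar R}.
Variables (r C : R).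
Hypotheses (r0 : 0 < r) (C0 : 0 <= C).
Hypothesis muC : forall p, (mu (nearset r p) <= C%:E)%E.

Lemma measurable_nearby_pair :
  measurable_fun [set: mplane * mplane] (fun x => (nearby r x.1 x.2)%:R : R).
Proof.
pose A : set (mplane * mplane) := [set x | nearby r x.1 x.2].
have mf (f : mplane -> R) : measurable_fun setT f ->
    measurable_fun [set: mplane * mplane] (fun x => `|f x.2 - f x.1|).
  move=> mf; apply: measurableT_comp => //; apply: measurable_funB.
    exact: measurableT_comp mf measurable_snd.
  exact: measurableT_comp mf measurable_fst.
have mA : measurable A.
  have -> : A = (fun x : mplane * mplane => `|x.2.1 - x.1.1|) @^-1` `]-oo, r[
     `&` (fun x : mplane * mplane => `|x.2.2 - x.1.2|) @^-1` `]-oo, r[.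
    apply/seteqP; split => x; rewrite /A /nearby /= !in_itv/=.
      by move=> /andP[].
    by move=> [-> ->].
  by apply: measurableI; rewrite -[X in measurable X]setTI;
    [apply: (mf fst)|apply: (mf snd)].
have -> : (fun x => (nearby r x.1 x.2)%:R : R) = \1_A.
  apply/funext => x; rewrite indicE; congr (_%:R); congr (nat_of_bool _).
  by apply/idP/idP => [H|/set_mem//]; apply/mem_set.
exact: measurable_indic.
Qed.

Lemma measurable_box_average (h : mplane -> R) : measurable_fun setT h ->
  (forall v, 0 <= h v) ->
  measurable_fun [set: mplane] (fun z => \int[@area R]_v ((nearby r z v)%:R * h v)%:E)%E.
Proof.
move=> mh h0.
pose f (x : mplane * mplane) := ((nearby r x.1 x.2)%:R * h x.2)%:E.
have mf : measurable_fun setT f.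
  apply/measurable_EFinP; apply: measurable_funM; first exact: measurable_nearby_pair.
  exact: measurableT_comp mh measurable_snd.
have f0 x : (0 <= f x)%E by rewrite lee_fin mulr_ge0.
exact: (@measurable_fun_fubini_tonelli_F _ _ _ _ R ar f mf f0).
Qed.

(** By Tonelli's theorem, each h(v) is counted with the mass of the box around
    v. *)
Lemma box_average (h : mplane -> R) : measurable_fun setT h ->
  (forall v, 0 <= h v) ->
  (\int[mu]_z \int[@area R]_v ((nearby r z v)%:R * h v)%:E <=
   C%:E * \int[@area R]_v (h v)%:E)%E.
Proof.
move=> mh h0.
pose mu' : {sigma_finite_measure set mplane -> \bar R} :=
  sigma_finite_copy (box_bounded_sigma_finite r0 muC).
pose f (x : mplane * mplane) := ((nearby r x.1 x.2)%:R * h x.2)%:E.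
have mf : measurable_fun setT f.
  apply/measurable_EFinP; apply: measurable_funM; first exact: measurable_nearby_pair.
  exact: measurableT_comp mh measurable_snd.
have f0 x : (0 <= f x)%E by rewrite lee_fin mulr_ge0.
have FT : (\int[mu]_z \int[@area R]_v ((nearby r z v)%:R * h v)%:E =
    \int[@area R]_v \int[mu]_z ((nearby r z v)%:R * h v)%:E)%E.
  exact: (@fubini_tonelli _ _ _ _ R mu' ar f mf f0).
rewrite FT.
have E v : (\int[mu]_z ((nearby r z v)%:R * h v)%:E = (h v)%:E * mu (nearset r v))%E.
  transitivity (\int[mu]_z (h v * (nearby r v z)%:R)%:E)%E.
    by apply: eq_integral => z _; rewrite mulrC nearbyC.
  rewrite integral_scale.
  - by rewrite integral_nearby.
  - exact: measurable_nearby.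
  - by move=> z; exact: ler0n.
  - exact: h0.
rewrite -integral_scale//; apply: ge0_le_integral => //.
- by move=> v _; apply: integral_ge0 => z _; rewrite lee_fin mulr_ge0.
- exact: (@measurable_fun_fubini_tonelli_G _ _ _ _ R mu' f mf f0).
- by apply/measurable_EFinP; exact: measurable_funM.
- move=> v _; rewrite E mulrC EFinM.
  by apply: lee_wpmul2l; [rewrite lee_fin|exact: muC].
Qed.

(** A Gaussian at w is at most a constant times the average over the box around
    w of a wider Gaussian, and box averages are harmless. *)
Lemma box_bounded_gaussian (beta : R) : 0 < beta -> exists2 K : R, 0 <= K &
  forall z, (\int[mu]_w (expR (- beta * sqdist z w))%:E <= K%:E)%E.
Proof.
move=> b0; have b2 : 0 < beta / 2 by rewrite divr_gt0.
have [G G0 GE] := integral_gaussian_plane b2.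
pose k := expR (beta * (2 * r ^+ 2)) / (2 * r) ^+ 2.
have k0 : 0 <= k by rewrite divr_ge0 ?expR_ge0 ?sqr_ge0.
exists (k * (C * G)) => [|z]; first by rewrite mulr_ge0// mulr_ge0.
pose h v := expR (- (beta / 2) * sqdist z v).
have mh : measurable_fun [set: mplane] h by exact: measurable_gaussian.
have h0 v : 0 <= h v by exact: expR_ge0.
have mnh w : measurable_fun [set: mplane] (fun v => (nearby r w v)%:R * h v).
  by apply: measurable_funM => //; exact: measurable_nearby.
have low w : ((expR (- beta * sqdist z w))%:E <=
    k%:E * \int[@area R]_v ((nearby r w v)%:R * h v)%:E)%E.
  have E1 : (\int[@area R]_v (expR (- beta * sqdist z w - beta * (2 * r ^+ 2)) * (nearby r w v)%:R)%:E <=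
      1%:E * \int[@area R]_v ((nearby r w v)%:R * h v)%:E)%E.
    apply: le_integral_scale => //.
    - by apply: measurable_funM => //; exact: measurable_nearby.
    - by move=> v; rewrite mulr_ge0 ?expR_ge0.
    move=> v; rewrite mul1r mulrC; case: (boolP (nearby r w v)) => [H|_]; last by rewrite !mul0r.
    rewrite !mul1r ler_expR.
    have := nearby_sqdist r0 H.
    have : sqdist z v <= 2 * sqdist z w + 2 * sqdist w v.
      rewrite -subr_ge0 [X in 0 <= X](_ : _ = (z.1 - 2 * w.1 + v.1) ^+ 2 + (z.2 - 2 * w.2 + v.2) ^+ 2).
        by rewrite addr_ge0// sqr_ge0.
      by rewrite /sqdist; ring.
    move=> H1 H2.
    have : beta * sqdist z v <= beta * (2 * sqdist z w + 2 * (2 * r ^+ 2)).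
      by apply: ler_wpM2l; [exact: ltW|lra].
    by move: (sqdist z v) (sqdist z w) => a b; lra.
  rewrite integral_scale in E1; [|exact: measurable_nearby|by move=> v; exact: ler0n|exact: expR_ge0].
  rewrite integral_nearby_area// mul1e in E1.
  apply: le_trans (lee_wpmul2l _ E1); last by rewrite lee_fin.
  rewrite -!EFinM lee_fin expRD expRN /k le_eqVlt; apply/orP; left; apply/eqP.
  by field; rewrite !gt_eqF ?expR_gt0.
apply: (@le_trans _ _ (\int[mu]_w (k%:E * \int[@area R]_v ((nearby r w v)%:R * h v)%:E))%E).
  apply: ge0_le_integral => //.
  - by apply/measurable_EFinP; exact: measurable_gaussian.
  - apply: measurable_funeM; exact: measurable_box_average.
rewrite ge0_integralZl_EFin//.
- rewrite (EFinM k); apply: lee_wpmul2l; first by rewrite lee_fin.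
  apply: le_trans (box_average mh h0) _.
  by rewrite GE -EFinM.
- by move=> w _; apply: integral_ge0 => v _; rewrite lee_fin mulr_ge0.
- exact: measurable_box_average.
Qed.

End box_bounded.

(** * The Carleson inequality for real harmonic functions *)

Section real_fock.
Context {R : realType}.
Variable alpha : R.
Hypothesis alpha0 : 0 < alpha.
Notation mplane := (measurableTypeR R * measurableTypeR R)%type.
Implicit Types (u P Q p q : R * R -> R) (c v z : R * R) (nu : {measure set mplane -> \bar R}).

Lemma integral_sum {d : measure_display} {T : measurableType d}
    (nu : {measure set T -> \bar R}) (f g : T -> R) :
  measurable_fun setT f -> measurable_fun setT g ->
  (forall x, 0 <= f x) -> (forall x, 0 <= g x) ->
  (\int[nu]_x (f x + g x)%:E = \int[nu]_x (f x)%:E + \int[nu]_x (g x)%:E)%E.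
Proof.
move=> mf mg f0 g0; under eq_integral do rewrite EFinD.
rewrite ge0_integralD//.
- by move=> x _; rewrite lee_fin.
- exact/measurable_EFinP.
- by move=> x _; rewrite lee_fin.
- exact/measurable_EFinP.
Qed.

Definition energy (nu : {measure set mplane -> \bar R}) u : \bar R :=
  (\int[nu]_z (u z ^+ 2 * gauss alpha z)%:E)%E.

Lemma energy_ge0 nu u : (0 <= energy nu u)%E.
Proof. by apply: integral_ge0 => z _; rewrite lee_fin mulr_ge0 ?sqr_ge0 ?gauss_ge0. Qed.

Lemma measurable_energy u : continuous u ->
  measurable_fun [set: mplane] (fun z => u z ^+ 2 * gauss alpha z).
Proof.
move=> cu; have cg := @continuous_gauss R alpha.
by apply: (@continuous_plane_measurable _ (fun z => u z ^+ 2 * gauss alpha z)); cont.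
Qed.

Lemma real_harmonic_continuous u : real_harmonic u -> continuous u.
Proof.
move=> [[C1u _ _] _]; case: (C1u) => _ _ cx cy.
exact: (partials_continuous (C1_partials C1u) cx cy).
Qed.

Lemma energy_pair nu u Q : continuous u -> continuous Q ->
  (\int[nu]_z ((u z ^+ 2 + Q z ^+ 2) * gauss alpha z)%:E = energy nu u + energy nu Q)%E.
Proof.
move=> cu cQ; rewrite /energy -integral_sum.
- by apply: eq_integral => z _; rewrite mulrDl.
- exact: measurable_energy.
- exact: measurable_energy.
- by move=> z; rewrite mulr_ge0 ?sqr_ge0 ?gauss_ge0.
- by move=> z; rewrite mulr_ge0 ?sqr_ge0 ?gauss_ge0.
Qed.

(** Passing to the holomorphic completion u + i Q costs a factor 2 only. *)
Lemma energy_completion u : real_harmonic u -> exists Q p q, holo u Q p q /\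
  (energy (@area R) u + energy (@area R) Q <= 2%:E * energy (@area R) u)%E.
Proof.
move=> hu; have [Q [Q0 h]] := harmonic_conjugate hu.
exists Q, (dx u), (fun z => - dy u z); split => //.
rewrite mule_natl mule2n leeD2l//.
exact: conjugate_energy h Q0.
Qed.

(** The local estimate for the completion, integrated over the whole plane. *)
Lemma real_pointwise : exists2 K : R, 0 <= K & forall u, real_harmonic u ->
  forall c, ((u c ^+ 2 * gauss alpha c)%:E <= K%:E * energy (@area R) u)%E.
Proof.
have [K K0 HK] := local_submean alpha0 (@ltr01 R).
exists (K * 2) => [|u hu c]; first by rewrite mulr_ge0// ltW.
have [Q [p [q [h E]]]] := energy_completion hu.
have [cu cQ] := holo_continuous h.
rewrite (EFinM K 2) -muleA; apply: (@le_trans _ _ (K%:E * (energy (@area R) u + energy (@area R) Q))%E); last first.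
  by apply: lee_wpmul2l => //; rewrite lee_fin ltW.
apply: (@le_trans _ _ (((u c ^+ 2 + Q c ^+ 2) * gauss alpha c)%:E)%E).
  by rewrite lee_fin ler_wpM2r ?gauss_ge0// lerDl sqr_ge0.
apply: (le_trans (HK _ _ _ _ h c)); rewrite -energy_pair//.
apply: lee_wpmul2l; first by rewrite lee_fin ltW.
have m : measurable_fun [set: mplane] (fun v => (u v ^+ 2 + Q v ^+ 2) * gauss alpha v).
  have cg := @continuous_gauss R alpha.
  by apply: (@continuous_plane_measurable _ (fun v => (u v ^+ 2 + Q v ^+ 2) * gauss alpha v)); cont.
have pos v : 0 <= (u v ^+ 2 + Q v ^+ 2) * gauss alpha v.
  by rewrite mulr_ge0 ?gauss_ge0// addr_ge0 ?sqr_ge0.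
rewrite -[leRHS]mul1e; apply: le_integral_scale => //.
- by apply: measurable_funM => //; exact: measurable_nearby.
- by move=> v; exact: mulr_ge0.
- by move=> v; rewrite mul1r ler_piMl//; case: nearby.
Qed.

Section carleson.
Variable mu : {measure set mplane -> \bar R}.
Variables (r C : R).
Hypotheses (r0 : 0 < r) (C0 : 0 <= C).
Hypothesis muC : forall c, (mu (nearset r c) <= C%:E)%E.

(** The local estimate for the completion, integrated against mu. *)
Lemma real_carleson : exists2 K : R, 0 <= K & forall u, real_harmonic u ->
  (energy mu u <= K%:E * energy (@area R) u)%E.
Proof.
have [K K0 HK] := local_submean alpha0 r0.
exists (K * (C * 2)) => [|u hu]; first by rewrite mulr_ge0 ?mulr_ge0// ltW.
have [Q [p [q [h E]]]] := energy_completion hu.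
have [cu cQ] := holo_continuous h.
rewrite (EFinM K) (EFinM C) -!muleA.
have K0' : (0 <= K%:E)%E by rewrite lee_fin ltW.
apply: (@le_trans _ _ (K%:E * (C%:E * (energy (@area R) u + energy (@area R) Q)))%E); last first.
  by apply: lee_wpmul2l => //; apply: lee_wpmul2l.
pose w v := (u v ^+ 2 + Q v ^+ 2) * gauss alpha v.
have m : measurable_fun [set: mplane] w.
  have cg := @continuous_gauss R alpha.
  by apply: (@continuous_plane_measurable _ w); rewrite /w; cont.
have pos v : 0 <= w v.
  by rewrite mulr_ge0 ?gauss_ge0// addr_ge0 ?sqr_ge0.
have := box_average r0 C0 muC m pos; rewrite energy_pair// => B.
apply: (@le_trans _ _ (K%:E * \int[mu]_z \int[@area R]_v ((nearby r z v)%:R * w v)%:E)%E); last exact: lee_wpmul2l.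
have mb := measurable_box_average r m pos.
rewrite -ge0_integralZl_EFin//.
- apply: ge0_le_integral => //.
  + by move=> z _; rewrite lee_fin mulr_ge0 ?sqr_ge0 ?gauss_ge0.
  + by apply/measurable_EFinP; exact: measurable_energy.
  + exact: measurable_funeM.
  + move=> z _; apply: le_trans (HK _ _ _ _ h z).
    by rewrite lee_fin ler_wpM2r ?gauss_ge0// lerDl sqr_ge0.
- by move=> z _; apply: integral_ge0 => v _; rewrite lee_fin mulr_ge0.
Qed.

End carleson.
End real_fock.

(** * Integral transforms of the kernel are harmonic *)

Section locally_bounded_partials.
Context {R : realType}.

(** Breaks a circle: the continuity of a transform follows from bounds on its
    partial derivatives, which are transforms as well. *)
Lemma partials_bounded_continuous (u ux uy : R * R -> R) : partials u ux uy ->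
  (forall N : R, exists2 K : R, 0 <= K & forall x y, `|x| <= N -> `|y| <= N ->
     `|ux (x, y)| <= K /\ `|uy (x, y)| <= K) ->
  continuous u.
Proof.
move=> du lb; apply/plane_continuousP => -[x y] e e0 /=.
have [K K0 HK] := lb (`|x| + `|y| + 1).
have K1 : 0 < 2 * (K + 1) by rewrite mulr_gt0// ltr_wpDl.
exists (Num.min 1 (e / (2 * (K + 1)))); first by rewrite lt_min ltr01 divr_gt0.
move=> h k; rewrite !lt_min => /andP[h1 /ltW he] /andP[k1 /ltW ke].
have bd (a b t : R) : `|b| < 1 -> Num.min a (a + b) <= t <= Num.max a (a + b) ->
    `|t| <= `|a| + 1.
  rewrite ltr_norml => /andP[b1 b2] tab.
  suff ta : `|t - a| <= 1.
    by rewrite -(subrKC a t) (le_trans (ler_normD _ _))// lerD2l.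
  rewrite ler_norml; move: tab.
  by have [|] := lerP a (a + b) => ab /andP[t1 t2]; lra.
have A := @derive_increment R (fun s => u (s, y + k)) (fun s => ux (s, y + k))
  x (x + h) 0 K (fun s => (du s (y + k)).1).
have B := @derive_increment R (fun s => u (x, s)) (fun s => uy (x, s))
  y (y + k) 0 K (fun s => (du x s).2).
have {}A : `|u (x + h, y + k) - u (x, y + k)| <= K * `|h|.
  have := A; rewrite (addrC x h) addrK mul0r subr0; apply => t tx.
  rewrite subr0; apply: (HK _ _ _ _).1.
    by rewrite (le_trans (bd x h t h1 _))// ?(addrC x)// -addrA lerD2l lerDr.
  rewrite (le_trans (ler_normD _ _))// lerD ?(ltW k1)// lerDr//.
have {}B : `|u (x, y + k) - u (x, y)| <= K * `|k|.
  have := B; rewrite (addrC y k) addrK mul0r subr0; apply => t ty.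
  rewrite subr0; apply: (HK _ _ _ _).2; first by rewrite -addrA lerDl addr_ge0.
  by rewrite (le_trans (bd y k t k1 _))// ?(addrC y)// lerD2r lerDr.
rewrite -(subrKA (u (x, y + k))) (le_trans (ler_normD _ _))//.
apply: (le_trans (lerD A B)); rewrite -mulrDr.
have KK : (K + 1) * (2 * (e / (2 * (K + 1)))) = e by field; rewrite gt_eqF// ltr_wpDl.
rewrite -KK; apply: ler_pM => //; first by rewrite lerDl.
by rewrite mulr_natl mulr2n lerD.
Qed.

End locally_bounded_partials.

Section exponential_transform.
Context {R : realType}.
Variable alpha : R.
Notation mplane := (measurableTypeR R * measurableTypeR R)%type.
Variable mu : {measure set mplane -> \bar R}.
Implicit Types (A B : mplane -> R) (z w : R * R).

Definition onenorm w : R := `|w.1| + `|w.2|.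

(** Integrable against every exponential: the class of densities that is stable
    under the multiplications by coordinates which differentiation of the kernel
    produces. *)
Definition superexp A : Prop := measurable_fun setT A /\ forall rho : R,
  mu.-integrable setT (EFin \o (fun w => A w * expR (rho * onenorm w))).

Lemma measurable_onenorm_exp (rho : R) :
  measurable_fun [set: mplane] (fun w => expR (rho * onenorm w)).
Proof.
have cn : continuous (fun w : R * R => onenorm w).
  have cabs : continuous (fun x : R => `|x|) by move=> x; exact: norm_continuous.
  apply: continuous_addE.
    exact: (@continuous_compE _ _ (fun x : R => `|x|) fst cabs continuous_fstE).
  exact: (@continuous_compE _ _ (fun x : R => `|x|) snd cabs continuous_sndE).
by apply: (@continuous_plane_measurable _ (fun w => expR (rho * onenorm w))); cont.
Qed.

Lemma le_superexp A A' : measurable_fun setT A' ->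
  superexp A -> (exists s, forall w, `|A' w| <= `|A w| * expR (s * onenorm w)) ->
  superexp A'.
Proof.
move=> mA' [mA iA] [s le]; split => // rho.
apply: (le_integrable measurableT _ _ (iA (rho + s))).
  apply/measurable_EFinP; apply: measurable_funM => //.
  exact: measurable_onenorm_exp.
move=> w _; rewrite /= lee_fin !normrM !(ger0_norm (expR_ge0 _)).
by rewrite mulrDl expRD (mulrC (expR (rho * _))) mulrA ler_wpM2r ?expR_ge0.
Qed.

Lemma superexpD A B : superexp A -> superexp B -> superexp (fun w => A w + B w).
Proof.
move=> [mA iA] [mB iB]; split; first exact: measurable_funD.
move=> rho; have := integrableD measurableT (iA rho) (iB rho).
by apply: eq_integrable => // w _; rewrite /= mulrDl EFinD.
Qed.

Lemma superexpZ (k : R) A : superexp A -> superexp (fun w => k * A w).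
Proof.
move=> [mA iA]; split; first exact: measurable_funM.
move=> rho; have := integrableZl measurableT k (iA rho).
by apply: eq_integrable => // w _; rewrite /= -EFinM mulrA.
Qed.

Lemma le_expR1 (x : R) : x <= expR x.
Proof. by rewrite (le_trans _ (expR_ge1Dx x))// lerDr. Qed.

Lemma superexp_coord1 A : superexp A -> superexp (fun w => w.1 * A w).
Proof.
move=> sA; have [mA _] := sA; apply: (le_superexp _ sA).
  by apply: measurable_funM.
exists 1 => w; rewrite normrM mulrC ler_wpM2l// mul1r (le_trans _ (le_expR1 _))//.
by rewrite lerDl.
Qed.

Lemma superexp_coord2 A : superexp A -> superexp (fun w => w.2 * A w).
Proof.
move=> sA; have [mA _] := sA; apply: (le_superexp _ sA).
  by apply: measurable_funM.
exists 1 => w; rewrite normrM mulrC ler_wpM2l// mul1r (le_trans _ (le_expR1 _))//.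
by rewrite lerDr.
Qed.

Lemma rdot_le (N : R) z w : onenorm z <= N -> alpha * rdot z w <= `|alpha| * N * onenorm w.
Proof.
move=> zN; rewrite (le_trans (ler_norm _))// normrM -mulrA ler_wpM2l//.
rewrite /rdot (le_trans (ler_normD _ _))// !normrM.
have z1 : `|z.1| <= N by rewrite (le_trans _ zN)// lerDl.
have z2 : `|z.2| <= N by rewrite (le_trans _ zN)// lerDr.
by rewrite /onenorm mulrDr lerD// ler_wpM2r.
Qed.

Lemma kcos_le (N : R) z w : onenorm z <= N ->
  `|kcos alpha z w| <= expR (`|alpha| * N * onenorm w).
Proof.
move=> zN; rewrite /kcos normrM ger0_norm ?expR_ge0// -[leRHS]mulr1.
by rewrite ler_pM ?expR_ge0// ?cos_max// ler_expR rdot_le.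
Qed.

Lemma ksin_le (N : R) z w : onenorm z <= N ->
  `|ksin alpha z w| <= expR (`|alpha| * N * onenorm w).
Proof.
move=> zN; rewrite /ksin normrM ger0_norm ?expR_ge0// -[leRHS]mulr1.
by rewrite ler_pM ?expR_ge0// ?sin_max// ler_expR rdot_le.
Qed.

(** The real part of the integral of (A - i B) K_z.  Both components are carried
    along because differentiation in z mixes them. *)
Definition transform A B z : R :=
  (\int[mu]_w (A w * kcos alpha z w + B w * ksin alpha z w))%R.

Definition majorant A B (N : R) w : R :=
  (`|A w| + `|B w|) * expR (`|alpha| * N * onenorm w).

Lemma majorant_ge0 A B N w : 0 <= majorant A B N w.
Proof. by rewrite mulr_ge0 ?expR_ge0// addr_ge0. Qed.

Lemma integrable_majorant A B N : superexp A -> superexp B ->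
  mu.-integrable setT (EFin \o majorant A B N).
Proof.
move=> [mA iA] [mB iB].
have := integrableD measurableT (integrable_abse (iA (`|alpha| * N)))
  (integrable_abse (iB (`|alpha| * N))).
apply: eq_integrable => // w _.
by rewrite /= -EFinD !normrM !(ger0_norm (expR_ge0 _)) /majorant mulrDl.
Qed.

Lemma transform_integrand_le A B N z w : onenorm z <= N ->
  `|A w * kcos alpha z w + B w * ksin alpha z w| <= majorant A B N w.
Proof.
move=> zN; rewrite (le_trans (ler_normD _ _))// (normrM (A w)) (normrM (B w)) /majorant mulrDl.
by apply: lerD; apply: ler_wpM2l => //; solve [exact: kcos_le|exact: ksin_le].
Qed.

Lemma continuous_kcos z : continuous (kcos alpha z).
Proof. by rewrite /kcos /rdot /rdet; cont. Qed.

Lemma continuous_ksin z : continuous (ksin alpha z).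
Proof. by rewrite /ksin /rdot /rdet; cont. Qed.

Lemma measurable_transform_integrand A B z :
  measurable_fun setT A -> measurable_fun setT B ->
  measurable_fun [set: mplane] (fun w => A w * kcos alpha z w + B w * ksin alpha z w).
Proof.
move=> mA mB; apply: measurable_funD; apply: measurable_funM => //.
  exact: (continuous_plane_measurable (@continuous_kcos z)).
exact: (continuous_plane_measurable (@continuous_ksin z)).
Qed.

Lemma integrable_transform A B z : superexp A -> superexp B ->
  mu.-integrable setT (EFin \o (fun w => A w * kcos alpha z w + B w * ksin alpha z w)).
Proof.
move=> sA sB; have [mA _] := sA; have [mB _] := sB.
apply: (le_integrable measurableT _ _ (integrable_majorant (onenorm z) sA sB)).
  by apply/measurable_EFinP; exact: measurable_transform_integrand.
move=> w _; rewrite /= lee_fin [leRHS]ger0_norm ?majorant_ge0//.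
exact: transform_integrand_le.
Qed.

Lemma transform_bounded A B (N : R) : superexp A -> superexp B ->
  exists2 K : R, 0 <= K & forall x y, `|x| <= N -> `|y| <= N ->
    `|transform A B (x, y)| <= K.
Proof.
move=> sA sB; exists (\int[mu]_w majorant A B (N + N) w)%R.
  by apply: Rintegral_ge0 => w _; exact: majorant_ge0.
move=> x y xN yN; rewrite (le_trans (le_normr_Rintegral _ _))//.
  exact: integrable_transform.
apply: le_Rintegral => //.
- by have := integrable_abse (integrable_transform (x, y) sA sB); apply: eq_integrable.
- exact: integrable_majorant.
- by move=> w _; apply: transform_integrand_le; rewrite lerD.
Qed.

(** (A - i B) multiplied by alpha w (the first two) and by - i alpha w, whose
    components are (dA2, dA1): the derivatives of K_z in the two coordinates of
    z. *)
Definition dA1 A B w := alpha * (w.1 * A w + w.2 * B w).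
Definition dB1 A B w := alpha * (w.1 * B w + (-1) * (w.2 * A w)).
Definition dA2 A B w := alpha * (w.2 * A w + (-1) * (w.1 * B w)).

Lemma superexp_dA1 A B : superexp A -> superexp B -> superexp (dA1 A B).
Proof.
move=> sA sB; apply: superexpZ; apply: superexpD.
  exact: superexp_coord1.
exact: superexp_coord2.
Qed.

Lemma superexp_dB1 A B : superexp A -> superexp B -> superexp (dB1 A B).
Proof.
move=> sA sB; apply: superexpZ; apply: superexpD; first exact: superexp_coord1.
by apply: superexpZ; exact: superexp_coord2.
Qed.

Lemma superexp_dA2 A B : superexp A -> superexp B -> superexp (dA2 A B).
Proof.
move=> sA sB; apply: superexpZ; apply: superexpD; first exact: superexp_coord2.
by apply: superexpZ; exact: superexp_coord1.
Qed.

Lemma derive_transform A B A' B' (g : R -> R * R) (x0 N : R) :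
  superexp A -> superexp B -> superexp A' -> superexp B' ->
  (forall (x : R) w, is_derive x 1
     (fun t : R => A w * kcos alpha (g t) w + B w * ksin alpha (g t) w)
     (A' w * kcos alpha (g x) w + B' w * ksin alpha (g x) w)) ->
  (forall x, `|x - x0| <= 1 -> onenorm (g x) <= N) ->
  is_derive x0 1 (fun t : R => transform A B (g t)) (transform A' B' (g x0)).
Proof.
move=> sA sB sA' sB' dg gN.
pose f (t : R) (w : mplane) := A w * kcos alpha (g t) w + B w * ksin alpha (g t) w.
have d1f (t : R) w : partial1of2 f t w = A' w * kcos alpha (g t) w + B' w * ksin alpha (g t) w.
  by rewrite partial1of2E (@derive_val _ _ _ _ _ _ _ (dg t w)).
have derf (t : R) w : derivable (f ^~ w) t 1.
  exact: (@ex_derive _ _ _ _ _ _ _ (dg t w)).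
have intf (t : R) : mu.-integrable setT (EFin \o f t) by exact: integrable_transform.
have intG := integrable_majorant N sA' sB'.
have x0I : `](x0 - 1), (x0 + 1)[%classic x0 by rewrite /= in_itv/=; lra.
have G0 := majorant_ge0 A' B' N.
have Gub (t : R) w : `](x0 - 1), (x0 + 1)[%classic t -> [set: mplane] w ->
    `|partial1of2 f t w| <= majorant A' B' N w.
  rewrite /= !in_itv/= d1f => /andP[t1 t2] _; apply: transform_integrand_le.
  by apply: gN; rewrite ler_norml; lra.
apply: DeriveDef.
  by apply: (@derivable_under_integral _ _ _ mu f setT _ x0 (x0 - 1) (x0 + 1) _ _ _ (majorant A' B' N)).
rewrite -derive1E.
rewrite (@differentiation_under_integral _ _ _ mu f setT _ x0 (x0 - 1) (x0 + 1) _ _ _ (majorant A' B' N)) //.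
by apply: eq_Rintegral => w _; rewrite d1f.
Qed.

Lemma partials_transform A B : superexp A -> superexp B ->
  partials (transform A B) (transform (dA1 A B) (dB1 A B))
    (transform (dA2 A B) (dA1 A B)).
Proof.
move=> sA sB x y.
have s1 := superexp_dA1 sA sB; have s2 := superexp_dB1 sA sB.
have s3 := superexp_dA2 sA sB; split.
- apply: (@derive_transform A B (dA1 A B) (dB1 A B) (fun t => (t, y)) x (`|x| + 1 + `|y|) sA sB s1 s2).
    move=> t w; rewrite /dA1 /dB1 /kcos /ksin /rdot /rdet /=.
    by derive_ring.
  move=> t tx; rewrite /onenorm /= lerD2r -(subrKC x t) (le_trans (ler_normD _ _))//.
  by rewrite lerD2l.
- apply: (@derive_transform A B (dA2 A B) (dA1 A B) (fun t => (x, t)) y (`|x| + (`|y| + 1)) sA sB s3 s1).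
    move=> t w; rewrite /dA1 /dA2 /kcos /ksin /rdot /rdet /=.
    by derive_ring.
  move=> t ty; rewrite /onenorm /= lerD2l -(subrKC y t) (le_trans (ler_normD _ _))//.
  by rewrite lerD2l.
Qed.

Lemma continuous_transform A B : superexp A -> superexp B ->
  continuous (transform A B).
Proof.
move=> sA sB; apply: (partials_bounded_continuous (partials_transform sA sB)) => N.
have s1 := superexp_dA1 sA sB; have s2 := superexp_dB1 sA sB.
have s3 := superexp_dA2 sA sB.
have [K1 K10 H1] := transform_bounded N s1 s2.
have [K2 K20 H2] := transform_bounded N s3 s1.
exists (K1 + K2) => [|x y xN yN]; first exact: addr_ge0.
split; first by rewrite (le_trans (H1 _ _ xN yN))// lerDl.
by rewrite (le_trans (H2 _ _ xN yN))// lerDr.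
Qed.

(** The second derivatives multiply the density by (alpha w)^2 and by
    (- i alpha w)^2, which cancel. *)
Lemma transform_harmonic A B : superexp A -> superexp B ->
  real_harmonic (transform A B).
Proof.
move=> sA sB.
have s1 := superexp_dA1 sA sB; have s2 := superexp_dB1 sA sB.
have s3 := superexp_dA2 sA sB.
have p0 := partials_transform sA sB.
have p1 := partials_transform s1 s2.
have p2 := partials_transform s3 s1.
have e1 := dx_partials p0; have e2 := dy_partials p0.
split; first split.
- exact: (partials_C1 p0 (continuous_transform s1 s2) (continuous_transform s3 s1)).
- rewrite e1; apply: (partials_C1 p1); apply: continuous_transform;
    [exact: superexp_dA1|exact: superexp_dB1|exact: superexp_dA2|exact: superexp_dA1].
- rewrite e2; apply: (partials_C1 p2); apply: continuous_transform;
    [exact: superexp_dA1|exact: superexp_dB1|exact: superexp_dA2|exact: superexp_dA1].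
move=> z; rewrite e1 e2 (dx_partials p1) (dy_partials p2) /transform.
rewrite -RintegralD//; last 2 first.
- by apply: integrable_transform; [exact: superexp_dA1|exact: superexp_dB1].
- by apply: integrable_transform; [exact: superexp_dA2|exact: superexp_dA1].
rewrite (_ : (fun _ => _) = fun=> 0); first by rewrite /Rintegral integral0.
by apply/funext => w; rewrite /dA1 /dB1 /dA2; ring.
Qed.

End exponential_transform.

(** * Boundedness of the Toeplitz operator *)

Section schur_test.
Context {R : realType}.
Variable alpha : R.
Hypothesis alpha0 : 0 < alpha.
Notation mplane := (measurableTypeR R * measurableTypeR R)%type.
Variable mu : {measure set mplane -> \bar R}.
Variables (r C : R).
Hypotheses (r0 : 0 < r) (C0 : 0 <= C).
Hypothesis muC : forall c, (mu (nearset r c) <= C%:E)%E.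
Implicit Types (g : R * R -> R) (z w : R * R).

Definition halfgauss z : R := expR (- (alpha / 2) * (z.1 ^+ 2 + z.2 ^+ 2)).
Definition offdiag z w : R := expR (- (alpha / 2) * sqdist z w).

Lemma halfgauss_sqr z : halfgauss z ^+ 2 = gauss alpha z.
Proof.
by rewrite gaussE /halfgauss -expRM_natl; congr expR; field.
Qed.

Lemma kcos_halfgauss z w :
  kcos alpha z w * (halfgauss w * halfgauss z) = cos (alpha * rdet z w) * offdiag z w.
Proof.
rewrite /kcos mulrAC mulrC -!expRD; congr (_ * expR _).
by rewrite /rdot /sqdist; field.
Qed.

Lemma offdiag_gt0 z w : 0 < offdiag z w. Proof. exact: expR_gt0. Qed.

Lemma offdiag_le1 z w : offdiag z w <= 1.
Proof.
by rewrite -expR0 ler_expR mulNr oppr_le0 mulr_ge0 ?sqdist_ge0 ?divr_ge0 ?(ltW alpha0).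
Qed.

Lemma measurable_offdiag z : measurable_fun [set: mplane] (offdiag z).
Proof. exact: measurable_gaussian. Qed.

Definition toeplitz_weight g w : R := 2 * g w * gauss alpha w.

Lemma measurable_toeplitz_weight g : continuous g ->
  measurable_fun [set: mplane] (toeplitz_weight g).
Proof.
move=> cg; have cG := @continuous_gauss R alpha.
by apply: (@continuous_plane_measurable _ (toeplitz_weight g)); rewrite /toeplitz_weight; cont.
Qed.

Lemma integrable_energy (nu : {measure set mplane -> \bar R}) g : continuous g -> (energy alpha nu g < +oo)%E ->
  nu.-integrable setT (EFin \o (fun w => g w ^+ 2 * gauss alpha w)).
Proof.
move=> cg fin; apply/integrableP; split.
  by apply/measurable_EFinP; exact: measurable_energy.
apply: le_lt_trans fin; rewrite le_eqVlt; apply/orP; left; apply/eqP.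
apply: eq_integral => w _; rewrite /= ger0_norm//.
by rewrite mulr_ge0 ?sqr_ge0 ?gauss_ge0.
Qed.

Lemma integrable_offdiag z : mu.-integrable setT (EFin \o offdiag z).
Proof.
have a2 : 0 < alpha / 2 by rewrite divr_gt0.
have [K K0 HK] := box_bounded_gaussian r0 C0 muC a2.
apply/integrableP; split; first by apply/measurable_EFinP; exact: measurable_offdiag.
apply: le_lt_trans (ltry K); apply: le_trans (HK z).
rewrite le_eqVlt; apply/orP; left; apply/eqP.
by apply: eq_integral => w _; rewrite /= ger0_norm// ltW// offdiag_gt0.
Qed.

(** 2 |g| e^(rho |w|) <= g^2 + e^(2 rho |w|), and the second exponential is absorbed
    by half of the Gaussian exponent. *)
Lemma superexp_toeplitz g : continuous g -> (energy alpha mu g < +oo)%E ->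
  superexp mu (toeplitz_weight g).
Proof.
move=> cg fin; split; first exact: measurable_toeplitz_weight.
move=> rho.
have i1 := integrable_energy cg fin.
have i2 := integrableZl measurableT (expR (4 * rho ^+ 2 / alpha)) (integrable_offdiag (0, 0)).
apply: (le_integrable measurableT _ _ (integrableD measurableT i1 i2)).
  apply/measurable_EFinP; apply: measurable_funM; first exact: measurable_toeplitz_weight.
  exact: measurable_onenorm_exp.
move=> w _; rewrite /= lee_fin [leRHS]ger0_norm; last first.
  by apply: addr_ge0; apply: mulr_ge0; rewrite ?sqr_ge0 ?expR_ge0 ?gauss_ge0 ?(ltW (offdiag_gt0 _ _)).
rewrite normrM (ger0_norm (expR_ge0 _)) normrM (ger0_norm (gauss_ge0 _ _)) normrM ger0_norm//.
have gE : gauss alpha w * expR (rho * onenorm w) ^+ 2 <=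
    expR (4 * rho ^+ 2 / alpha) * offdiag (0, 0) w.
  rewrite gaussE /offdiag -expRM_natl -!expRD ler_expR sqdist0 /onenorm.
  have q (t : R) : 2 * rho * `|t| <= alpha / 2 * t ^+ 2 + 2 * rho ^+ 2 / alpha.
    have -> : alpha / 2 * t ^+ 2 = alpha / 2 * `|t| ^+ 2 by rewrite real_normK ?num_real.
    rewrite -subr_ge0 [X in 0 <= X](_ : _ = (alpha * `|t| - 2 * rho) ^+ 2 / (2 * alpha)).
      by rewrite divr_ge0 ?sqr_ge0// mulr_ge0// ltW.
    by field; rewrite gt_eqF.
  have q1 := q w.1; have q2 := q w.2.
  have -> : 4 * rho ^+ 2 / alpha = 2 * (2 * rho ^+ 2 / alpha) by field; rewrite gt_eqF.
  by move: (2 * rho ^+ 2 / alpha) q1 q2 => X q1 q2; lra.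
apply: le_trans (lerD (lexx _) gE).
set G := gauss alpha w; set e := expR (rho * onenorm w).
have G0 : 0 <= G := gauss_ge0 _ _.
have -> : g w ^+ 2 = `|g w| ^+ 2 by rewrite real_normK ?num_real.
rewrite -subr_ge0 [X in 0 <= X](_ : _ = G * (`|g w| - e) ^+ 2); first by rewrite mulr_ge0 ?sqr_ge0.
by ring.
Qed.

Lemma offdiag_energy_fin g z : continuous g -> (energy alpha mu g < +oo)%E ->
  mu.-integrable setT (EFin \o (fun w => g w ^+ 2 * gauss alpha w * offdiag z w)).
Proof.
move=> cg fin; apply: (le_integrable measurableT _ _ (integrable_energy cg fin)).
  apply/measurable_EFinP; apply: measurable_funM; first exact: measurable_energy.
  exact: measurable_offdiag.
move=> w _; rewrite /= lee_fin normrM ler_piMr// ger0_norm ?offdiag_le1//.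
exact: ltW (offdiag_gt0 _ _).
Qed.

(** Schur's test.  The Cauchy-Schwarz inequality a^2 <= 4 G I is used through
    the inequalities 2 s a <= 4 I + s^2 G, which need only be integrated, and are
    applied at s = a / G. *)
Lemma toeplitz_pointwise : exists2 G : R, 0 <= G & forall g z, continuous g ->
  (energy alpha mu g < +oo)%E ->
  ((transform alpha mu (toeplitz_weight g) (fun=> 0) z ^+ 2 * gauss alpha z)%:E <=
   G%:E * \int[mu]_w (g w ^+ 2 * gauss alpha w * offdiag z w)%:E)%E.
Proof.
have a2 : 0 < alpha / 2 by rewrite divr_gt0.
have [G G0 HG] := box_bounded_gaussian r0 C0 muC a2.
exists (4 * (G + 1)) => [|g z cg fin]; first by rewrite mulr_ge0// addr_ge0.
have sA := superexp_toeplitz cg fin.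
have iI := offdiag_energy_fin z cg fin.
have iT := integrable_transform alpha z sA (superexpZ 0 sA).
set I := (\int[mu]_w _)%E.
have IE : I = (\int[mu]_w (g w ^+ 2 * gauss alpha w * offdiag z w))%R%:E.
  by rewrite /Rintegral fineK//; exact: integrable_fin_num.
have kE : (\int[mu]_w offdiag z w)%R <= G + 1.
  rewrite -lee_fin /Rintegral fineK; last exact: integrable_fin_num (integrable_offdiag z).
  by apply: le_trans (HG z) _; rewrite lee_fin lerDl.
pose phi w := 2 * g w * halfgauss w * cos (alpha * rdet z w).
pose a := transform alpha mu (toeplitz_weight g) (fun=> 0) z * halfgauss z.
have iphi : mu.-integrable setT (EFin \o (fun w => phi w * offdiag z w)).
  have := integrableZl measurableT (halfgauss z) iT; apply: eq_integrable => // w _.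
  rewrite /= -EFinM; congr EFin; rewrite !mul0r addr0 /phi -[in RHS]mulrA -kcos_halfgauss.
  by rewrite /toeplitz_weight -halfgauss_sqr; ring.
have aE : a = (\int[mu]_w (phi w * offdiag z w))%R.
  rewrite /a mulrC /transform -RintegralZl//; last first.
    by move: iT; apply: eq_integrable => // w _; rewrite /= mul0r.
  apply: eq_Rintegral => w _; rewrite mul0r addr0 /phi -[in RHS]mulrA -kcos_halfgauss.
  by rewrite /toeplitz_weight -halfgauss_sqr; ring.
rewrite IE -EFinM lee_fin; set J := (\int[mu]_w _)%R.
have G1 : 0 < G + 1 by rewrite ltr_wpDl.
have main (s : R) : 2 * s * a <= 4 * J + s ^+ 2 * (G + 1).
  apply: (@le_trans _ _ (4 * J + s ^+ 2 * (\int[mu]_w offdiag z w)%R)); last first.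
    by rewrite lerD2l ler_wpM2l// sqr_ge0.
  have i4 : mu.-integrable setT (EFin \o (fun w => 4 * (g w ^+ 2 * gauss alpha w * offdiag z w))).
    by have := integrableZl measurableT 4 iI; apply: eq_integrable.
  have is2 : mu.-integrable setT (EFin \o (fun w => s ^+ 2 * offdiag z w)).
    by have := integrableZl measurableT (s ^+ 2) (integrable_offdiag z); apply: eq_integrable.
  rewrite aE -!RintegralZl//; [|exact: integrable_offdiag].
  rewrite -RintegralD//; apply: le_Rintegral => //.
  - by have := integrableZl measurableT (2 * s) iphi; apply: eq_integrable.
  - by have := integrableD measurableT i4 is2; apply: eq_integrable.
  move=> w _; have k0 := offdiag_gt0 z w.
  have -> : 2 * s * (phi w * offdiag z w) = 2 * s * phi w * offdiag z w by ring.
  have -> : 4 * (g w ^+ 2 * gauss alpha w * offdiag z w) + s ^+ 2 * offdiag z w =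
     (4 * (g w ^+ 2 * gauss alpha w) + s ^+ 2) * offdiag z w by ring.
  rewrite ler_wpM2r ?(ltW k0)//.
  apply: (@le_trans _ _ (phi w ^+ 2 + s ^+ 2)).
    by rewrite -subr_ge0 [X in 0 <= X](_ : _ = (phi w - s) ^+ 2) ?sqr_ge0//; ring.
  rewrite lerD2r /phi -halfgauss_sqr.
  have c1 : cos (alpha * rdet z w) ^+ 2 <= 1.
    by have := cos2Dsin2 (alpha * rdet z w); have := sqr_ge0 (sin (alpha * rdet z w)); lra.
  have -> : (2 * g w * halfgauss w * cos (alpha * rdet z w)) ^+ 2 =
     4 * (g w ^+ 2 * halfgauss w ^+ 2) * cos (alpha * rdet z w) ^+ 2 by ring.
  by rewrite ler_piMr// mulr_ge0// mulr_ge0// sqr_ge0.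
rewrite -halfgauss_sqr -exprMn -/a.
have := main (a / (G + 1)).
have -> : 2 * (a / (G + 1)) * a = 2 * (a ^+ 2 / (G + 1)) by ring.
have -> : (a / (G + 1)) ^+ 2 * (G + 1) = a ^+ 2 / (G + 1) by field; rewrite gt_eqF.
move=> H; have {H} : a ^+ 2 / (G + 1) <= 4 * J by lra.
by rewrite ler_pdivrMr// mulrAC.
Qed.

(** Tonelli's theorem integrates the pointwise bound in z, where the Gaussian
    has constant mass. *)
Lemma toeplitz_energy : exists2 K : R, 0 <= K & forall g, real_harmonic g ->
  (energy alpha mu g < +oo)%E ->
  (energy alpha (@area R) (transform alpha mu (toeplitz_weight g) (fun=> 0)%R) <=
   K%:E * energy alpha mu g)%E.
Proof.
have [G G0 HG] := toeplitz_pointwise.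
have a2 : 0 < alpha / 2 by rewrite divr_gt0.
have [G2 G20 HG2] := integral_gaussian_plane a2.
exists (G * G2) => [|g hg fin]; first exact: mulr_ge0.
have cg := real_harmonic_continuous hg.
pose mu' : {sigma_finite_measure set mplane -> \bar R} :=
  sigma_finite_copy (box_bounded_sigma_finite r0 muC).
pose ar : {sigma_finite_measure set mplane -> \bar R} :=
  sigma_finite_copy (@area_sigma_finite R).
pose h w := g w ^+ 2 * gauss alpha w.
have mh : measurable_fun [set: mplane] h by exact: measurable_energy.
have h0 w : 0 <= h w by rewrite mulr_ge0 ?sqr_ge0 ?gauss_ge0.
pose f (x : mplane * mplane) := (h x.2 * offdiag x.1 x.2)%:E.
have mf : measurable_fun setT f.
  apply/measurable_EFinP; apply: measurable_funM.
    exact: measurableT_comp mh measurable_snd.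
  apply: measurableT_comp => //; apply: measurable_funM => //.
  have md (i : mplane -> R) : measurable_fun setT i ->
      measurable_fun [set: mplane * mplane] (fun x => (i x.2 - i x.1) ^+ 2).
    move=> mi; apply: measurable_funX; apply: measurable_funB.
      exact: measurableT_comp mi measurable_snd.
    exact: measurableT_comp mi measurable_fst.
  by apply: measurable_funD; [apply: (md fst)|apply: (md snd)].
have f0 x : (0 <= f x)%E by rewrite lee_fin mulr_ge0// ltW// offdiag_gt0.
have FT : (\int[@area R]_z \int[mu]_w (h w * offdiag z w)%:E =
    \int[mu]_w \int[@area R]_z (h w * offdiag z w)%:E)%E.
  exact: (@fubini_tonelli _ _ _ _ R ar mu' f mf f0).
have mF : measurable_fun [set: mplane] (fun z => \int[mu]_w (h w * offdiag z w)%:E)%E.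
  exact: (@measurable_fun_fubini_tonelli_F _ _ _ _ R mu' f mf f0).
have F0 z : (0 <= \int[mu]_w (h w * offdiag z w)%:E)%E.
  by apply: integral_ge0 => w _; rewrite lee_fin mulr_ge0// ltW// offdiag_gt0.
set u := transform _ _ _ _.
have cu : continuous u.
  have sA := superexp_toeplitz cg fin.
  apply: continuous_transform => //.
  by have := superexpZ 0 sA; congr (superexp mu _); apply/funext => w; rewrite mul0r.
apply: (@le_trans _ _ (\int[@area R]_z (G%:E * \int[mu]_w (h w * offdiag z w)%:E))%E).
  apply: ge0_le_integral => //.
  - by move=> z _; rewrite lee_fin mulr_ge0 ?sqr_ge0 ?gauss_ge0.
  - by apply/measurable_EFinP; exact: measurable_energy.
  - exact: measurable_funeM.
  - by move=> z _; exact: HG.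
rewrite ge0_integralZl_EFin//.
rewrite (EFinM G) -muleA; apply: lee_wpmul2l; first by rewrite lee_fin.
rewrite FT.
have E w : (\int[@area R]_z (h w * offdiag z w)%:E = G2%:E * (h w)%:E)%E.
  transitivity (\int[@area R]_z (h w * offdiag w z)%:E)%E.
    apply: eq_integral => z _; congr (_ * _)%:E; congr expR; congr (_ * _).
    by rewrite /sqdist; ring.
  rewrite integral_scale; [|exact: measurable_offdiag|by move=> z; exact: ltW (offdiag_gt0 _ _)|exact: h0].
  by rewrite /offdiag HG2 muleC.
under eq_integral do rewrite E.
rewrite ge0_integralZl_EFin//.
- by move=> w _; rewrite lee_fin.
- exact/measurable_EFinP.
Qed.

End schur_test.

(** * The three conditions *)

Section complex_fock.
Local Open Scope complex_scope.
Local Open Scope ring_scope.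
Context {R : realType}.
Variable alpha : R.
Hypothesis alpha0 : 0 < alpha.
Notation mplane := (measurableTypeR R * measurableTypeR R)%type.
Implicit Types (f : R * R -> R[i]) (z w : R * R) (nu mu : {measure set mplane -> \bar R}).

Definition re_part f : R * R -> R := fun z => complex.Re (f z).
Definition im_part f : R * R -> R := fun z => complex.Im (f z).

Definition cenergy nu f : \bar R :=
  (energy alpha nu (re_part f) + energy alpha nu (im_part f))%E.

Lemma cenergy_ge0 nu f : (0 <= cenergy nu f)%E.
Proof. by rewrite adde_ge0// energy_ge0. Qed.

Lemma harmonic_parts f : harmonic_fun f ->
  real_harmonic (re_part f) /\ real_harmonic (im_part f).
Proof. by []. Qed.

Lemma harmonic_fun_continuous f : harmonic_fun f ->
  continuous (re_part f) /\ continuous (im_part f).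
Proof.
move=> /harmonic_parts[h1 h2].
by split; [exact: real_harmonic_continuous h1|exact: real_harmonic_continuous h2].
Qed.

Lemma cenergyE nu f : harmonic_fun f ->
  cenergy nu f = (\int[nu]_z (cmod (f z) ^+ 2 * gauss alpha z)%:E)%E.
Proof.
move=> /harmonic_fun_continuous[c1 c2]; rewrite /cenergy -energy_pair//.
by apply: eq_integral => z _; rewrite cmod_sqr.
Qed.

Lemma measurable_cmod_gauss f : harmonic_fun f ->
  measurable_fun [set: mplane] (fun z => cmod (f z) ^+ 2 * gauss alpha z).
Proof.
move=> /harmonic_fun_continuous[c1 c2].
have -> : (fun z => cmod (f z) ^+ 2 * gauss alpha z) =
    (fun z => re_part f z ^+ 2 * gauss alpha z + im_part f z ^+ 2 * gauss alpha z).
  by apply/funext => z; rewrite cmod_sqr mulrDl.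
by apply: measurable_funD; exact: measurable_energy.
Qed.

Lemma weighted_energy nu f : harmonic_fun f ->
  (\int[nu]_z (cmod (weighted alpha f z) ^+ 2)%:E)%E = cenergy nu f.
Proof.
move=> hf; rewrite cenergyE//; apply: eq_integral => z _.
rewrite /weighted cmodM exprMn cmod_real -expRM_natl /gauss.
by congr (_ * expR _)%:E; field.
Qed.

Lemma alphapi_gt0 : 0 < alpha / pi.
Proof. by rewrite divr_gt0// pi_gt0. Qed.

Lemma density_energy f : harmonic_fun f ->
  (\int[@area R]_z (cmod (f z) ^+ 2 * fock_density alpha z)%:E)%E =
  ((alpha / pi)%:E * cenergy (@area R) f)%E.
Proof.
move=> hf; rewrite cenergyE// -integral_scale.
- by apply: eq_integral => z _; rewrite /fock_density mulrCA.
- exact: measurable_cmod_gauss.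
- by move=> z; rewrite mulr_ge0 ?sqr_ge0 ?gauss_ge0.
- exact: ltW alphapi_gt0.
Qed.

Lemma in_fockE f : in_fock alpha f <->
  harmonic_fun f /\ (cenergy (@area R) f < +oo)%E.
Proof.
have ap := alphapi_gt0; split=> -[hf fin]; split => //.
  move: fin (cenergy_ge0 (@area R) f); rewrite density_energy//.
  case: (cenergy _ _) => [x _ _| |//]; first exact: ltry.
  by rewrite gt0_muley ?lte_fin// ltxx.
by rewrite density_energy// lte_mul_pinfty// lee_fin ltW.
Qed.

Lemma fock_normE f : harmonic_fun f ->
  fock_norm alpha f = Num.sqrt (fine ((alpha / pi)%:E * cenergy (@area R) f)).
Proof.
move=> hf; rewrite /fock_norm -density_energy//; congr (Num.sqrt (fine _)).
apply: eq_integral => z _; congr EFin; rewrite cmod_sqr.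
by case: (f z) => a b /=; rewrite !(mul0r, mulr0, subr0) mulrN opprK -!expr2.
Qed.

(** Covers both H_z and its normalization h_z. *)
Definition scaled_kernel z (k : R[i]) w : R[i] := fock_H alpha z w * k.

Section kernel_membership.
Variable z : R * R.

(** The real part of (a - i b) K_z: a family closed under differentiation in w
    that contains the real kernel. *)
Definition wave (a b : R) w : R := a * kcos alpha z w + b * ksin alpha z w.

Lemma partials_wave (a b : R) : partials (wave a b)
  (wave (alpha * (z.1 * a - z.2 * b)) (alpha * (z.2 * a + z.1 * b)))
  (wave (alpha * (z.2 * a + z.1 * b)) (alpha * (z.2 * b - z.1 * a))).
Proof.
move=> x y; rewrite /wave /kcos /ksin /rdot /rdet /=; split; derive_ring.
Qed.

Lemma continuous_wave (a b : R) : continuous (wave a b).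
Proof. by rewrite /wave /kcos /ksin /rdot /rdet; cont. Qed.

Lemma wave_harmonic (a b : R) : real_harmonic (wave a b).
Proof.
have p0 := partials_wave a b.
have e1 := dx_partials p0; have e2 := dy_partials p0.
split; first split.
- by apply: (partials_C1 p0); exact: continuous_wave.
- by rewrite e1; apply: (partials_C1 (partials_wave _ _)); exact: continuous_wave.
- by rewrite e2; apply: (partials_C1 (partials_wave _ _)); exact: continuous_wave.
move=> w; rewrite e1 e2 (dx_partials (partials_wave _ _)) (dy_partials (partials_wave _ _)).
by rewrite /wave; ring.
Qed.

Variable k : R[i].
Let f := scaled_kernel z k.

Lemma kernel_harmonic : harmonic_fun f.
Proof.
have E w : f w = Complex (wave (2 * complex.Re k) 0 w) (wave (2 * complex.Im k) 0 w).
  rewrite /f /scaled_kernel fock_HE /wave; case: k => a b /=; rewrite realCE mulCE.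
  by congr Complex; ring.
have -> : f = (fun w => Complex (wave (2 * complex.Re k) 0 w) (wave (2 * complex.Im k) 0 w)).
  exact/funext.
by split; exact: wave_harmonic.
Qed.

Lemma kernel_cmod w : cmod (f w) ^+ 2 * gauss alpha w =
  4 * cmod k ^+ 2 * expR (alpha * (z.1 ^+ 2 + z.2 ^+ 2)) *
   (cos (alpha * rdet z w) ^+ 2 * expR (- alpha * sqdist z w)).
Proof.
rewrite /f /scaled_kernel cmodM exprMn fock_HE cmod_real -mulrA -kcos_gauss; ring.
Qed.

End kernel_membership.

Lemma kernel_energy : exists2 G : R, 0 <= G & forall z (k : R[i]),
  (cenergy (@area R) (scaled_kernel z k)
   <= (cmod k ^+ 2 * expR (alpha * (z.1 ^+ 2 + z.2 ^+ 2)) * G)%:E)%E.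
Proof.
have [G G0 HG] := integral_gaussian_plane alpha0.
exists (4 * G) => [|z k]; first exact: mulr_ge0.
rewrite cenergyE; last exact: kernel_harmonic.
pose c := 4 * cmod k ^+ 2 * expR (alpha * (z.1 ^+ 2 + z.2 ^+ 2)).
have c0 : 0 <= c by rewrite mulr_ge0 ?expR_ge0// mulr_ge0// sqr_ge0.
have -> : cmod k ^+ 2 * expR (alpha * (z.1 ^+ 2 + z.2 ^+ 2)) * (4 * G) = c * G.
  by rewrite /c; ring.
rewrite (EFinM c) -(HG z); apply: le_integral_scale.
- exact: measurable_cmod_gauss (kernel_harmonic z k).
- exact: measurable_gaussian.
- by move=> w; rewrite mulr_ge0 ?sqr_ge0 ?gauss_ge0.
- by move=> w; exact: expR_ge0.
- exact: c0.
move=> w; rewrite kernel_cmod ler_wpM2l// ler_piMl ?expR_ge0//.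
Qed.

Lemma kernel_in_fock z k : in_fock alpha (scaled_kernel z k).
Proof.
apply/in_fockE; split; first exact: kernel_harmonic.
by have [G _ HG] := kernel_energy; exact: le_lt_trans (HG z k) (ltry _).
Qed.

Variable mu : {measure set mplane -> \bar R}.

Lemma berezinE z : (berezin alpha mu z = \int[mu]_u (berezin_density alpha z u)%:E)%E.
Proof. by apply: eq_integral => u _; rewrite fock_h_gauss. Qed.

Lemma berezin_box_bounded : berezin_bounded alpha mu ->
  exists r C : R, [/\ 0 < r, 0 <= C & forall c, (mu (nearset r c) <= C%:E)%E].
Proof.
move=> [M HM]; have [r [K [r0 K0 HK]]] := two_densities alpha0.
have M0 : 0 <= M.
  rewrite -lee_fin; apply: le_trans (HM (0, 0)); rewrite berezinE.
  by apply: integral_ge0 => u _; rewrite lee_fin berezin_density_ge0.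
exists r, (K * (M + M)); split => // [|c]; first by rewrite mulr_ge0 ?addr_ge0// ltW.
have [p' Hp] := HK c.
have mb z : measurable_fun [set: mplane] (berezin_density alpha z).
  exact: (continuous_plane_measurable (@continuous_berezin_density _ alpha z)).
rewrite -integral_nearby (EFinM K).
apply: (@le_trans _ _ (K%:E * \int[mu]_u (berezin_density alpha c u + berezin_density alpha p' u)%:E)%E).
  apply: le_integral_scale.
  - exact: measurable_nearby.
  - exact: measurable_funD.
  - by move=> u; exact: ler0n.
  - by move=> u; rewrite addr_ge0 ?berezin_density_ge0.
  - exact: ltW.
  move=> u; case: (boolP (nearby r c u)) => [/Hp//|_].
  by rewrite mulr_ge0 ?addr_ge0 ?berezin_density_ge0// ltW.
apply: lee_wpmul2l; first by rewrite lee_fin ltW.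
rewrite integral_sum//; [|exact: berezin_density_ge0|exact: berezin_density_ge0].
by rewrite EFinD -!berezinE leeD.
Qed.

Lemma berezin_carleson : berezin_bounded alpha mu -> fock_carleson alpha mu.
Proof.
move=> /berezin_box_bounded[r [C [r0 C0 muC]]].
have [K K0 HK] := real_carleson alpha0 r0 C0 muC.
exists (K + 1) => [|f [hf _]]; first by rewrite ltr_wpDl.
rewrite !weighted_energy//; apply: (@le_trans _ _ (K%:E * cenergy (@area R) f)%E).
  rewrite /cenergy muleDr ?ge0_adde_def ?inE ?energy_ge0//.
  by have [h1 h2] := harmonic_parts hf; apply: leeD; [exact: HK h1|exact: HK h2].
by apply: lee_wpmul2r; [exact: cenergy_ge0|rewrite lee_fin lerDl].
Qed.

Lemma carleson_berezin : fock_carleson alpha mu -> berezin_bounded alpha mu.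
Proof.
move=> [C C0 HC]; have [G G0 HG] := kernel_energy.
exists (C * (2^-1 * G)) => z.
have := HC _ (kernel_in_fock z (sqrtC (fock_H alpha z z))^-1).
rewrite !weighted_energy; [|exact: kernel_harmonic|exact: kernel_harmonic].
rewrite {1}cenergyE; last exact: kernel_harmonic.
move=> H; apply: (le_trans H).
rewrite (EFinM C); apply: lee_wpmul2l; first by rewrite lee_fin ltW.
apply: (le_trans (HG _ _)); rewrite lee_fin ler_wpM2r//.
rewrite cmodV exprVn cmod_sqrtC cmod_fock_Hzz le_eqVlt; apply/orP; left; apply/eqP.
by field; rewrite gt_eqF// expR_gt0.
Qed.

Lemma toeplitz_integrandE f z w : toeplitz_integrand alpha f z w =
  Complex (toeplitz_weight alpha (re_part f) w * kcos alpha z w)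
          (toeplitz_weight alpha (im_part f) w * kcos alpha z w).
Proof.
rewrite /toeplitz_integrand fock_HE /toeplitz_weight /re_part /im_part.
case: (f w) => a b /=; rewrite realCE conjCE !mulCE.
by congr Complex; ring.
Qed.

Lemma toeplitzE f z : toeplitz alpha mu f z =
  Complex (transform alpha mu (toeplitz_weight alpha (re_part f)) (fun=> 0) z)
          (transform alpha mu (toeplitz_weight alpha (im_part f)) (fun=> 0) z).
Proof.
rewrite /toeplitz /cintegral /transform; congr Complex; apply: eq_Rintegral => w _;
  by rewrite toeplitz_integrandE /= mul0r addr0.
Qed.

Lemma berezin_toeplitz : berezin_bounded alpha mu -> toeplitz_bounded alpha mu.
Proof.
move=> /berezin_box_bounded[r [C [r0 C0 muC]]].
have [K K0 HK] := real_carleson alpha0 r0 C0 muC.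
have [T T0 HT] := toeplitz_energy alpha0 r0 C0 muC.
have fin u : real_harmonic u -> (energy alpha (@area R) u < +oo)%E ->
    (energy alpha mu u < +oo)%E.
  by move=> hu fu; apply: le_lt_trans (HK u hu) _; rewrite lte_mul_pinfty.
have parts f : in_fock alpha f -> [/\ real_harmonic (re_part f), real_harmonic (im_part f),
    (energy alpha (@area R) (re_part f) < +oo)%E & (energy alpha (@area R) (im_part f) < +oo)%E].
  move=> /in_fockE[/harmonic_parts[h1 h2] E]; split=> //; apply: le_lt_trans E.
    by rewrite /cenergy leeDl// energy_ge0.
  by rewrite /cenergy leeDr// energy_ge0.
have sup u : real_harmonic u -> (energy alpha (@area R) u < +oo)%E ->
    superexp mu (toeplitz_weight alpha u).
  move=> hu fu; apply: (superexp_toeplitz alpha0 r0 C0 muC).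
    exact: real_harmonic_continuous.
  exact: fin.
have sup0 u : real_harmonic u -> (energy alpha (@area R) u < +oo)%E ->
    superexp mu (fun=> 0 : R).
  move=> hu fu; have := superexpZ 0 (sup u hu fu).
  by congr (superexp mu _); apply/funext => w; rewrite mul0r.
have harm f : in_fock alpha f -> harmonic_fun (toeplitz alpha mu f).
  move=> /parts[h1 h2 e1 e2].
   have -> : toeplitz alpha mu f = (fun z =>
      Complex (transform alpha mu (toeplitz_weight alpha (re_part f)) (fun=> 0) z)
        (transform alpha mu (toeplitz_weight alpha (im_part f)) (fun=> 0) z)).
    by apply/funext => z; exact: toeplitzE.
  split; apply: transform_harmonic;
    [exact: sup|exact: sup0 e1|exact: sup|exact: sup0 e1].
have bound f : in_fock alpha f -> (cenergy (@area R) (toeplitz alpha mu f) <=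
    (T * K)%:E * cenergy (@area R) f)%E.
  move=> /parts[h1 h2 e1 e2].
  have B u : real_harmonic u -> (energy alpha (@area R) u < +oo)%E ->
     (energy alpha (@area R) (transform alpha mu (toeplitz_weight alpha u) (fun=> 0%R)) <=
      (T * K)%:E * energy alpha (@area R) u)%E.
    move=> hu fu; apply: le_trans (HT u hu (fin u hu fu)) _.
    by rewrite (EFinM T) -muleA; apply: lee_wpmul2l; [rewrite lee_fin|exact: HK].
  rewrite /cenergy muleDr ?ge0_adde_def ?inE ?energy_ge0//.
  rewrite (_ : re_part (toeplitz _ _ _) = transform alpha mu (toeplitz_weight alpha (re_part f)) (fun=> 0)); last first.
    by apply/funext => z; rewrite /re_part toeplitzE.
  rewrite (_ : im_part (toeplitz _ _ _) = transform alpha mu (toeplitz_weight alpha (im_part f)) (fun=> 0)); last first.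
    by apply/funext => z; rewrite /im_part toeplitzE.
  by apply: leeD; apply: B.
have TK0 : 0 <= T * K by rewrite mulr_ge0.
have memb f : in_fock alpha f -> in_fock alpha (toeplitz alpha mu f).
  move=> inf; apply/in_fockE; split; first exact: harm.
  apply: le_lt_trans (bound f inf) _; rewrite lte_mul_pinfty//.
  by case/in_fockE: inf.
split => //.
- move=> f /parts[h1 h2 e1 e2] z; split.
    have := integrable_transform alpha z (sup _ h1 e1) (sup0 _ h1 e1).
    by apply: eq_integrable => // w _; rewrite /= mul0r addr0 toeplitz_integrandE.
  have := integrable_transform alpha z (sup _ h2 e2) (sup0 _ h1 e1).
  by apply: eq_integrable => // w _; rewrite /= mul0r addr0 toeplitz_integrandE.
exists (Num.sqrt (T * K)) => f inf.
have hf : harmonic_fun f by case: inf.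
have fT : (cenergy (@area R) (toeplitz alpha mu f) < +oo)%E by case/in_fockE: (memb f inf).
have ff : (cenergy (@area R) f < +oo)%E by case/in_fockE: inf.
rewrite (fock_normE (harm f inf)) (fock_normE hf).
rewrite -sqrtrM// ler_sqrt; last first.
  rewrite mulr_ge0// fine_ge0// mule_ge0 ?cenergy_ge0// lee_fin; exact: ltW alphapi_gt0.
have := bound f inf.
have c1 := cenergy_ge0 (@area R) f; have c2 := cenergy_ge0 (@area R) (toeplitz alpha mu f).
move: (cenergy _ _) (cenergy _ (toeplitz _ _ _)) fT ff c1 c2 => [x| |] [y| |]//= _ _ x0 y0.
rewrite -!EFinM !lee_fin /= => yx.
by rewrite [leRHS]mulrCA ler_wpM2l// ltW// alphapi_gt0.
Qed.

(** X is the value of T_mu H_z at z.  It is bounded through the pointwise estimate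
    by the norm of T_mu H_z, hence by that of H_z. *)
Lemma toeplitz_berezin : toeplitz_bounded alpha mu -> berezin_bounded alpha mu.
Proof.
move=> [intT memT [C HC]].
have [G G0 HG] := kernel_energy.
have [K K0 HK] := real_pointwise alpha0.
exists (1 + K * (C ^+ 2 * G)) => z.
pose f := scaled_kernel z 1.
have inf : in_fock alpha f by exact: kernel_in_fock.
have hf : harmonic_fun f by case: inf.
have [hT eT] := (in_fockE _).1 (memT f inf).
pose e := expR (alpha * (z.1 ^+ 2 + z.2 ^+ 2)).
have e0 : 0 < e by exact: expR_gt0.
have ge1 : gauss alpha z * e = 1 by rewrite gaussE mulNr -expRD addNr expR0.
pose X := complex.Re (toeplitz alpha mu f z).
have ET : (cenergy (@area R) (toeplitz alpha mu f) <= (C ^+ 2 * (e * G))%:E)%E.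
  have Ef := HG z 1; have := HC f inf.
  have c1 := cenergy_ge0 (@area R) f; have c2 := cenergy_ge0 (@area R) (toeplitz alpha mu f).
  rewrite (fock_normE hT) (fock_normE hf).
  have ff : (cenergy (@area R) f <= (e * G)%:E)%E.
    apply: le_trans Ef _; rewrite lee_fin.
    have -> : cmod (1 : R[i]) ^+ 2 = 1 by rewrite -[1 : R[i]]/(1%:C) cmod_real expr1n.
    by rewrite mul1r.
  move: (cenergy _ f) (cenergy _ (toeplitz _ _ _)) ff eT c1 c2 => [x| |] [y| |]//= + _ x0 y0.
  rewrite !lee_fin in x0 y0 *; move=> xe H.
  have a0 := alphapi_gt0.
  have S : (alpha / pi * y) <= C ^+ 2 * (alpha / pi * x).
    have s1 : 0 <= alpha / pi * y by rewrite mulr_ge0// ltW.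
    have s2 : 0 <= alpha / pi * x by rewrite mulr_ge0// ltW.
    rewrite -(sqr_sqrtr s1) -(sqr_sqrtr s2) -exprMn lerXn2r ?nnegrE ?sqrtr_ge0//.
    exact: le_trans (sqrtr_ge0 _) H.
  have {}S : y <= C ^+ 2 * x by rewrite -(ler_pM2l a0) mulrCA.
  by apply: (le_trans S); rewrite ler_wpM2l// sqr_ge0.
have PX : X ^+ 2 * gauss alpha z <= K * (C ^+ 2 * (e * G)).
  rewrite -lee_fin; have [h1 _] := harmonic_parts hT; apply: le_trans (HK _ h1 z) _.
  rewrite (EFinM K); apply: lee_wpmul2l; first by rewrite lee_fin.
  by apply: le_trans ET; rewrite /cenergy leeDl// energy_ge0.
have XE : berezin alpha mu z = (2^-1 * gauss alpha z * X)%:E.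
  have [iR _] := intT f inf z.
  have -> : X = (\int[mu]_w complex.Re (toeplitz_integrand alpha f z w))%R by [].
  rewrite -RintegralZl// /Rintegral fineK; last first.
    apply: integrable_fin_num => //.
    by have := integrableZl measurableT (2^-1 * gauss alpha z) iR; apply: eq_integrable.
  rewrite berezinE; apply: eq_integral => w _; congr EFin.
  rewrite toeplitz_integrandE /toeplitz_weight /re_part /f /scaled_kernel fock_HE mulr1 /=.
  have -> : 2^-1 * gauss alpha z * (2 * (2 * kcos alpha z w) * gauss alpha w * kcos alpha z w) =
     2 * gauss alpha z * (kcos alpha z w ^+ 2 * gauss alpha w) by field.
  by rewrite kcos_gauss -/e mulrA -(mulrA 2) ge1 mulr1.
rewrite XE lee_fin.
set Y := 2^-1 * gauss alpha z * X.
have Y2 : Y ^+ 2 <= K * (C ^+ 2 * G).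
  have -> : Y ^+ 2 = 4^-1 * (gauss alpha z * (X ^+ 2 * gauss alpha z)) by rewrite /Y; field.
  apply: (@le_trans _ _ (gauss alpha z * (X ^+ 2 * gauss alpha z))).
    rewrite ler_piMl//; last by lra.
    by rewrite mulr_ge0 ?gauss_ge0// mulr_ge0 ?sqr_ge0 ?gauss_ge0.
  apply: (@le_trans _ _ (gauss alpha z * (K * (C ^+ 2 * (e * G))))).
    by rewrite ler_wpM2l ?gauss_ge0.
  have -> : gauss alpha z * (K * (C ^+ 2 * (e * G))) = (gauss alpha z * e) * (K * (C ^+ 2 * G)) by ring.
  by rewrite ge1 mul1r.
apply: le_trans (lerD (lexx 1) Y2).
have := sqr_ge0 (Y - 2^-1); rewrite sqrrB; lra.
Qed.

End complex_fock.

Theorem theorem3p1 (R : realType) (alpha : R) (halpha : 0 < alpha)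
    (mu : {measure set (measurableTypeR R * measurableTypeR R) -> \bar R}) :
  (toeplitz_bounded alpha mu <-> berezin_bounded alpha mu) /\
  (berezin_bounded alpha mu <-> fock_carleson alpha mu).
Proof.
split; split.
- exact: toeplitz_berezin.
- exact: berezin_toeplitz.
- exact: berezin_carleson.
- exact: carleson_berezin.
Qed.
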